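(* Let $\mathcal{L}$ be DLR or HAR. Every inductive $\mathcal{L}$-inequality $s\le t$ is elementary and canonical. That is: (elementarity) there is a first-order sentence $\chi$ in the language of dual frames of perfect $\mathcal{L}$-algebras such that for every perfect $\mathcal{L}$-algebra $\mathbb{A}$, $\mathbb{A}\models s\le t$ if and only if $\mathbb{A}_+\models\chi$; (canonicity) for every $\mathcal{L}$-algebra $\mathbb{A}$, if $\mathbb{A}\models s\le t$ then $\mathbb{A}^\delta\models s\le t$.
   Context: BDL means bounded distributive lattice. $A^\partial$ is the order dual of $A$, $A^1=A$, and $A^\epsilon=\prod_iA^{\epsilon_i}$ for an order type $\epsilon\in\{1,\partial\}^n$. $J^\infty(A)$, $M^\infty(A)$ are the sets of completely join-irreducible, respectively completely meet-irreducible, elements. Algebras. Fix $\eta_f,\eta_g\in\{1,\partial\}$, $\epsilon_k\in\{1,\partial\}^m$, $\epsilon_l\in\{1,\partial\}^n$. A DLR is $(A,f,g,k,l)$ with $A$ a BDL, $f:A^{\eta_f}\to A$ preserving finite nonempty joins, $g:A^{\eta_g}\to A$ preserving finite nonempty meets, $k:A^{\epsilon_k}\to A$ preserving finite nonempty joins in each coordinate, and $l:A^{\epsilon_l}\to A$ preserving finite nonempty meets in each coordinate. A HAR is a DLR whose lattice is a Heyting algebra, with $\to$ as an additional basic operation. Such an algebra is perfect if $A$ is complete, completely distributive, completely join-generated by $J^\infty(A)$ and completely meet-generated by $M^\infty(A)$, and $f,k$ (resp. $g,l$) preserve arbitrary nonempty joins (resp. meets) in each coordinate. $\mathcal{L}$-terms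 are built from propositional variables, $\top,\bot,\wedge,\vee,f,g,k,l$ and, for HAR, $\to$. $\mathbb{A}\models s\le t$ means $h(s)\le h(t)$ for all assignments $h$. Canonical extensions. $A^\delta$ is the (unique up to isomorphism) complete BDL containing $A$ as a sublattice such that every element of $A^\delta$ is both a join of meets and a meet of joins of elements of $A$, and for all $S,T\subseteq A$ with $\bigwedge S\le\bigvee T$ there are finite $F\subseteq S$, $G\subseteq T$ with $\bigwedge F\le\bigvee G$. $K(A^\delta)$ and $O(A^\delta)$ are the sets of meets, respectively joins, of subsets of $A$. For a monotone $h:C\to B$ between BDLs, $h^\sigma(u)=\bigvee\{\bigwedge\{h(a): x\le a\in C\}: u\ge x\in K(C^\delta)\}$ and $h^\pi(u)=\bigwedge\{\bigvee\{h(a): y\ge a\in C\}: u\le y\in O(C^\delta)\}$ for $u\in C^\delta$. These are applied to the operations as monotone maps $A^\epsilon\to A$, identifying $(A^\epsilon)^\delta$ with $(A^\delta)^\epsilon$. $\mathbb{A}^\delta=(A^\delta,f^\sigma,g^\sigma,k^\sigma,l^\pi)$, for HAR with $\to$ the Heyting implication of $A^\delta$. Dual frames. For a perfect $\mathcal{L}$-algebra $\mathbb{A}$ let $\kappa:J^\infty(\mathbb{A})\to M^\infty(\mathbb{A})$, $\kappa(x)=\bigvee\{a\in\mathbb{A}: x\not\le a\}$. The dual frame $\mathbb{A}_+$ is the first-order structure with universe $J^\infty(\mathbb{A})$, the order of $\mathbb{A}$ restricted to it, and, for each operation $h\in\{f,g,k,l\}$ and each set $P$ of coordinates of $h$, a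 relation $R_{h,P}$ of arity $1+|P|$ between $x\in J^\infty(\mathbb{A})$ and $(y_e)_{e\in P}$. For $h\in\{f,k\}$: $R_{h,P}(x,\overline y)$ iff $x\le h(\overline u)$, where $u_e=y_e$ (resp. $\kappa(y_e)$) if $e\in P$ has order type $1$ (resp. $\partial$), and $u_e=\bot$ (resp. $\top$) if $e\notin P$ has order type $1$ (resp. $\partial$). For $h\in\{g,l\}$: $R_{h,P}(x,\overline y)$ iff $h(\overline u)\le\kappa(x)$, where $u_e=\kappa(y_e)$ (resp. $y_e$) if $e\in P$ has order type $1$ (resp. $\partial$), and $u_e=\top$ (resp. $\bot$) if $e\notin P$ has order type $1$ (resp. $\partial$). (For unary $f$ and $g$ of order type $1$ these encode the distributive Kripke frames with impossible worlds: $N_f$ and $N_g$ are the complements of $R_{f,\varnothing}$, $R_{g,\varnothing}$, and $S_f,S_g$ are the restrictions of $R_{f,\{1\}},R_{g,\{1\}}$ to $N_f$, $N_g$ in the first coordinate.) Signed generation trees. $\pm s$: sign the root $\pm$, keep the sign at children in monotone coordinates and switch it at children in antitone coordinates. For an order type $\epsilon$ on $p_1,\dots,p_n$, an $\epsilon$-critical leaf is $+p_i$ with $\epsilon_i=1$ or $-p_i$ with $\epsilon_i=\partial$; an $\epsilon$-critical branch ends in such a leaf. A signed (sub)tree agrees with $\epsilon$ if all its variable leaves are $\epsilon$-critical; $\epsilon^\partial$ is the order type obtained by swapping $1$ and $\partial$. Classification of nodes. Skeleton (SAC) nodes: $+\vee,+\wedge,+f,+k,-\wedge,-\vee,-g,-l$,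 and for HAR also $-\to$. PIA nodes: SMP nodes $+\wedge,+g,-\vee,-f$, and SRR nodes $+\vee,-\wedge$, and for HAR also $+\to$. A branch is good if it is the concatenation of paths $P_1,P_2$ (one possibly of length $0$) with $P_1$ a path from the leaf consisting (apart from variable nodes) only of PIA nodes and $P_2$ consisting (apart from variable nodes) only of Skeleton nodes. Inductive inequalities. Let $\epsilon$ be an order type and $\Omega$ an irreflexive transitive relation on $p_1,\dots,p_n$. $*s$ is $(\Omega,\epsilon)$-inductive if every $\epsilon$-critical branch, with leaf labelled $p_i$ say, is good, and moreover, for every binary SRR node $\alpha\circ\beta$ in $P_1$ (with the branch running through $\beta$; up to commutativity for $\vee,\wedge$): the signed subtree of $\alpha$ in $*s$ agrees with $\epsilon^\partial$ (in particular, critical branches pass through $+\to$ only via its second coordinate), and $p_j<_\Omega p_i$ for every $p_j$ occurring in $\alpha$. $s\le t$ is $(\Omega,\epsilon)$-inductive if $+s$ and $-t$ both are, and inductive if it is so for some $\Omega,\epsilon$. *)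

(* Defs.v *)
From HB Require Import structures.
From Stdlib Require List.
From mathcomp Require Import all_boot all_order.
From mathcomp Require Import boolp classical_sets cardinality.

Set Implicit Arguments.
Unset Strict Implicit.
Unset Printing Implicit Defensive.

Import Order.TTheory.
Local Open Scope classical_set_scope.
Local Open Scope order_scope.

(* Order types and signs are booleans: false is 1 (resp. +), true is the      *)
(* order dual (resp. -), so that signs propagate by exclusive or (+).         *)

(* A^eps: the product over i of A (eps i = false) or of its order dual.       *)
Definition epow (n : nat) (eps : 'I_n -> bool) (T : Type) := {ffun 'I_n -> T}.

Section EpowOrder.
Context (n : nat) (eps : 'I_n -> bool) (d : Order.disp_t) (T : porderType d).

HB.instance Definition _ := Choice.copy (epow eps T) {ffun 'I_n -> T}.

Definition le_epow (u v : epow eps T) : bool :=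
  [forall i, if eps i then v i <= u i else u i <= v i].

Fact le_epow_refl : reflexive le_epow.
Proof. by move=> u; apply/forallP => i; case: (eps i). Qed.

Fact le_epow_anti : antisymmetric le_epow.
Proof.
move=> u v /andP[/forallP uv /forallP vu]; apply/ffunP => i.
by move: (uv i) (vu i); case: (eps i) => h1 h2; apply/le_anti/andP; split.
Qed.

Fact le_epow_trans : transitive le_epow.
Proof.
move=> v u w /forallP uv /forallP vw; apply/forallP => i.
move: (uv i) (vw i); case: (eps i) => h1 h2; first exact: le_trans h2 h1.
exact: le_trans h1 h2.
Qed.

HB.instance Definition _ := Order.Le_isPOrder.Build d (epow eps T)
  le_epow_refl le_epow_anti le_epow_trans.

Definition upd (u : epow eps T) (i : 'I_n) (a : T) : epow eps T :=
  [ffun j => if j == i then a else u j].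

End EpowOrder.

Definition emap (n : nat) (eps : 'I_n -> bool) (T U : Type) (e : T -> U)
  (u : epow eps T) : epow eps U := [ffun i => e (u i)].

(* Lattices *)

(* Where X has no supremum (resp. infimum), the value is a default.           *)
Definition Sup d (T : tbLatticeType d) (X : set T) : T := supremum \bot X.
Definition Inf d (T : tbLatticeType d) (X : set T) : T := infimum \top X.

Definition complete d (T : porderType d) : Prop :=
  forall X : set T, supremums X !=set0 /\ infimums X !=set0.

Definition completely_distributive d (T : tbLatticeType d) : Prop :=
  forall (I : Type) (X : I -> set T),
    Inf [set Sup (X i) | i in [set: I]] =
    Sup [set Inf (range phi) | phi in [set phi : I -> T | forall i, X i (phi i)]].

Definition Jinf d (T : porderType d) : set T :=
  [set j | forall X, supremums X j -> X j].
Definition Minf d (T : porderType d) : set T :=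
  [set m | forall X, infimums X m -> X m].

Definition join_generated d (T : porderType d) (G : set T) : Prop :=
  forall a, exists2 X, X `<=` G & supremums X a.
Definition meet_generated d (T : porderType d) (G : set T) : Prop :=
  forall a, exists2 X, X `<=` G & infimums X a.

Definition kappa d (T : tbLatticeType d) (x : T) : T :=
  Sup [set a | ~~ (x <= a)].

(* Joins (b = false) and meets (b = true).                                    *)
Definition bounds d (T : porderType d) (b : bool) (X : set T) : set T :=
  if b then infimums X else supremums X.

(* For every coordinate i, h preserves the joins (b = false) or the meets     *)
(* (b = true) of the sets X in Q; that of X in the i-th coordinate is taken   *)
(* in the order dual of A when eps i = true.                                  *)
Definition preserves d (A : porderType d) (b : bool) (Q : set (set A))
    n (eps : 'I_n -> bool) (h : epow eps A -> A) : Prop :=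
  forall (u : epow eps A) (i : 'I_n) (X : set A) (x : A),
    Q X -> bounds (eps i (+) b) X x ->
    bounds b [set h (upd u i a) | a in X] (h (upd u i x)).

(* Algebras *)

Record signature := Signature {
  eta_f : bool;
  eta_g : bool;
  arity_k : nat;
  eps_k : 'I_arity_k -> bool;
  arity_l : nat;
  eps_l : 'I_arity_l -> bool }.

Inductive opsym := Of | Og | Ok | Ol.

Definition is_meet_op (o : opsym) : bool :=
  match o with Of | Ok => false | Og | Ol => true end.

Definition arity (S : signature) (o : opsym) : nat :=
  match o with Of | Og => 1 | Ok => arity_k S | Ol => arity_l S end.

Definition otype (S : signature) (o : opsym) : 'I_(arity S o) -> bool :=
  match o with
  | Of => fun=> eta_f S
  | Og => fun=> eta_g S
  | Ok => @eps_k S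
  | Ol => @eps_l S
  end.

Arguments otype S o _ : clear implicits.

Inductive lang := DLR | HAR.
Definition is_HAR (L : lang) : bool := if L is HAR then true else false.

Record operations (S : signature) (L : lang) (A : Type) := Operations {
  opn : forall o : opsym, epow (otype S o) A -> A;
  imp : is_HAR L -> A -> A -> A }.
Arguments opn {S L A} _ o _.
Arguments imp {S L A} _ _ _ _.

Definition is_algebra S L d (A : tbDistrLatticeType d)
    (O : operations S L A) : Prop :=
  (forall o, preserves (is_meet_op o)
     [set X | X !=set0 /\ finite_set X] (opn O o)) /\
  (forall (har : is_HAR L) (a b c : A),
     (Order.meet c a <= b) = (c <= imp O har a b)).

Definition is_perfect S L d (A : tbDistrLatticeType d)
    (O : operations S L A) : Prop :=
  [/\ is_algebra O, complete A, completely_distributive A,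
      join_generated (@Jinf d A) /\ meet_generated (@Minf d A) &
      forall o, preserves (is_meet_op o) [set X | X !=set0] (opn O o)].

(* Terms *)

Inductive node (L : lang) :=
| NTop | NBot | NAnd | NOr | NImp of is_HAR L | NOp of opsym.
Arguments NTop {L}.
Arguments NBot {L}.
Arguments NAnd {L}.
Arguments NOr {L}.
Arguments NOp {L}.

Definition node_arity (S : signature) L (nd : node L) : nat :=
  match nd with
  | NTop | NBot => 0
  | NAnd | NOr | NImp _ => 2
  | NOp o => arity S o
  end.

Definition node_otype (S : signature) L (nd : node L) :
    'I_(node_arity S nd) -> bool :=
  match nd with
  | NTop | NBot | NAnd | NOr => fun=> false
  | NImp _ => fun i => i == ord0
  | NOp o => otype S o
  end.

(* The propositional variables p_1, ..., p_N are indexed by 'I_N.             *)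
Inductive term (S : signature) (L : lang) (N : nat) :=
| Var (i : 'I_N)
| Node (nd : node L) (args : 'I_(node_arity S nd) -> term S L N).

Definition node_eval S L d (A : tbDistrLatticeType d) (O : operations S L A)
    (nd : node L) : ('I_(node_arity S nd) -> A) -> A :=
  match nd return ('I_(node_arity S nd) -> A) -> A with
  | NTop => fun=> \top
  | NBot => fun=> \bot
  | NAnd => fun a => Order.meet (a ord0) (a ord_max)
  | NOr => fun a => Order.join (a ord0) (a ord_max)
  | NImp har => fun a => imp O har (a ord0) (a ord_max)
  | NOp o => fun a => opn O o (finfun a : epow (otype S o) A)
  end.

Fixpoint eval S L N d (A : tbDistrLatticeType d) (O : operations S L A)
    (v : 'I_N -> A) (s : term S L N) : A :=
  match s with
  | Var i => v i
  | Node nd args => node_eval O (fun j => eval O v (args j))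
  end.

Definition valid S L N d (A : tbDistrLatticeType d) (O : operations S L A)
    (s t : term S L N) : Prop :=
  forall v : 'I_N -> A, eval O v s <= eval O v t.

(* Canonical extensions *)

Section Extension.
Context (d d' : Order.disp_t) (D : porderType d) (Dx : porderType d').

Definition closed_elts (e : D -> Dx) : set Dx :=
  [set x | exists X : set D, infimums (e @` X) x].
Definition open_elts (e : D -> Dx) : set Dx :=
  [set x | exists X : set D, supremums (e @` X) x].

Context (b b' : Order.disp_t) (B : porderType b) (Bx : tbLatticeType b').

(* Extensions of h : D -> B along embeddings e, j of D, B in their canonical  *)
(* extensions.                                                                *)
Definition sigma_ext (e : D -> Dx) (j : B -> Bx) (h : D -> B) (u : Dx) : Bx :=
  Sup [set Inf [set j (h a) | a in [set a | x <= e a]]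
      | x in [set x | closed_elts e x /\ x <= u]].

Definition pi_ext (e : D -> Dx) (j : B -> Bx) (h : D -> B) (u : Dx) : Bx :=
  Inf [set Sup [set j (h a) | a in [set a | e a <= y]]
      | y in [set y | open_elts e y /\ u <= y]].

End Extension.

(* The library's bounded-lattice morphisms {tblmorphism A -> C} are only      *)
(* required to preserve top and bottom, hence the explicit conditions.        *)
Definition canonical_extension d (A : tbDistrLatticeType d)
    d' (C : tbDistrLatticeType d') (e : A -> C) : Prop :=
  [/\ injective e /\ [/\ Order.meet_morphism e, Order.join_morphism e,
                         e \bot = \bot & e \top = \top],
      complete C,
      join_generated (closed_elts e) /\ meet_generated (open_elts e) &
      forall X Y : set A, Inf (e @` X) <= Sup (e @` Y) ->
        exists F G : seq A,
          [/\ [set` F] `<=` X, [set` G] `<=` Y &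
              \meet_(a <- F) a <= \join_(a <- G) a]].

(* The canonical extension of A^eps is C^eps, with the coordinatewise         *)
(* embedding; the sets K and O of C^eps are computed in its product order.    *)
Definition delta S L d (A : tbDistrLatticeType d) (O : operations S L A)
    d' (C : tbDistrLatticeType d') (e : A -> C) : operations S L C :=
  {| opn := fun o =>
       match o return epow (otype S o) C -> C with
       | Of => sigma_ext (emap e) e (opn O Of)
       | Og => sigma_ext (emap e) e (opn O Og)
       | Ok => sigma_ext (emap e) e (opn O Ok)
       | Ol => pi_ext (emap e) e (opn O Ol)
       end;
     imp := fun _ a b => Sup [set c | Order.meet c a <= b] |}.

(* First-order logic of dual frames *)

Record frame (S : signature) := Frame {
  world :> Type;
  dle : world -> world -> Prop;
  drel : forall (o : opsym) (P : {set 'I_(arity S o)}),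
    world -> ({i | i \in P} -> world) -> Prop }.

(* Formulas with free variables in V; a quantifier binds None.                *)
Inductive form (S : signature) (V : Type) : Type :=
| FBot
| FEq of V & V
| FLe of V & V
| FRel (o : opsym) (P : {set 'I_(arity S o)}) (x : V) (y : {i | i \in P} -> V)
| FAnd of form S V & form S V
| FOr of form S V & form S V
| FImp of form S V & form S V
| FAll of form S (option V)
| FEx of form S (option V).

Definition sentence (S : signature) := form S void.

Fixpoint sat S (F : frame S) V (phi : form S V) : (V -> F) -> Prop :=
  match phi with
  | FBot => fun=> False
  | FEq x y => fun v => v x = v y
  | FLe x y => fun v => dle (v x) (v y)
  | FRel o P x y => fun v => drel (v x) (v \o y)
  | FAnd p q => fun v => sat p v /\ sat q v
  | FOr p q => fun v => sat p v \/ sat q v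
  | FImp p q => fun v => sat p v -> sat q v
  | FAll p => fun v => forall w : F, sat p (fun z => oapp v w z)
  | FEx p => fun v => exists w : F, sat p (fun z => oapp v w z)
  end.

Definition models S (F : frame S) (chi : sentence S) : Prop :=
  @sat S F void chi (fun z : void => match z with end).

Section DualFrame.
Context (S : signature) (L : lang) (d : Order.disp_t) (A : tbDistrLatticeType d).
Context (O : operations S L A).

(* The cases {g, l} and order dual coordinate each swap y with kappa y and    *)
(* bottom with top, whence the exclusive or.                                  *)
Definition frame_args (o : opsym) (P : {set 'I_(arity S o)})
    (y : {i | i \in P} -> A) : epow (otype S o) A :=
  [ffun i => match insub i, otype S o i (+) is_meet_op o with
             | Some p, false => y p
             | Some p, true => kappa (y p)
             | None, false => \bot
             | None, true => \top
             end].

Definition dual_rel (o : opsym) (P : {set 'I_(arity S o)})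
    (x : A) (y : {i | i \in P} -> A) : Prop :=
  if is_meet_op o then opn O o (frame_args y) <= kappa x
  else x <= opn O o (frame_args y).

Definition dual_frame : frame S :=
  {| world := {x : A | Jinf x};
     dle := fun x y => sval x <= sval y;
     drel := fun o P x y => dual_rel (sval x) (fun p => sval (y p)) |}.

End DualFrame.

(* Signed generation trees *)

(* A node on a branch: its sign, its label, its subtrees and the coordinate   *)
(* through which the branch continues towards the leaf.                       *)
Record step (S : signature) (L : lang) (N : nat) := Step {
  st_sign : bool;
  st_node : node L;
  st_args : 'I_(node_arity S st_node) -> term S L N;
  st_dir : 'I_(node_arity S st_node) }.

(* branch b s P i b': in the tree of s with root signed b, P lists the nodes, *)
(* from the root, of a branch whose leaf is p_i signed b'.                    *)
Inductive branch S L N :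
    bool -> term S L N -> seq (step S L N) -> 'I_N -> bool -> Prop :=
| branch_leaf b i : branch b (Var S L i) [::] i b
| branch_node b nd (args : 'I_(node_arity S nd) -> term S L N) j P i b' :
    branch (b (+) node_otype j) (args j) P i b' ->
    branch b (Node args) (Step b args j :: P) i b'.

Definition occurs S L N (i : 'I_N) (s : term S L N) : Prop :=
  exists P b, branch false s P i b.

Definition critical N (eps : 'I_N -> bool) (i : 'I_N) (b : bool) : bool :=
  b == eps i.

Definition agrees S L N (eps : 'I_N -> bool) (b : bool) (s : term S L N) : Prop :=
  forall P i b', branch b s P i b' -> critical eps i b'.

Definition skeleton L (b : bool) (nd : node L) : bool :=
  match nd, b with
  | NOr, false | NAnd, false | NOp Of, false | NOp Ok, false => true
  | NAnd, true | NOr, true | NOp Og, true | NOp Ol, true | NImp _, true => true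
  | _, _ => false
  end.

Definition SMP L (b : bool) (nd : node L) : bool :=
  match nd, b with
  | NAnd, false | NOp Og, false => true
  | NOr, true | NOp Of, true => true
  | _, _ => false
  end.

Definition SRR L (b : bool) (nd : node L) : bool :=
  match nd, b with
  | NOr, false | NImp _, false => true
  | NAnd, true => true
  | _, _ => false
  end.

Definition PIA L (b : bool) (nd : node L) : bool := SMP b nd || SRR b nd.

(* The condition on an SRR node of P_1 on a critical branch to p_i: the       *)
(* branch takes the second coordinate of an implication and any coordinate of *)
(* a join or a meet, and alpha is the subtree at the other coordinate.        *)
Definition SRR_ok S L N (Omega : rel 'I_N) (eps : 'I_N -> bool) (i : 'I_N)
    (st : step S L N) : Prop :=
  (if st_node st is NImp _ then nat_of_ord (st_dir st) = 1%N else True) /\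
  forall j, j != st_dir st ->
    agrees (fun p => ~~ eps p) (st_sign st (+) node_otype j) (st_args j) /\
    (forall p, occurs p (st_args j) -> Omega p i).

Definition inductive_tree S L N (Omega : rel 'I_N) (eps : 'I_N -> bool)
    (b : bool) (s : term S L N) : Prop :=
  forall P i b', branch b s P i b' -> critical eps i b' ->
    exists P2 P1,
      [/\ P = P2 ++ P1,
          all (fun st => PIA (st_sign st) (st_node st)) P1,
          all (fun st => skeleton (st_sign st) (st_node st)) P2 &
          forall st, List.In st P1 -> SRR (st_sign st) (st_node st) ->
            SRR_ok Omega eps i st].

Definition inductive_ineq S L N (s t : term S L N) : Prop :=
  exists (Omega : rel 'I_N) (eps : 'I_N -> bool),
    [/\ irreflexive Omega, transitive Omega,
        inductive_tree Omega eps false s & inductive_tree Omega eps true t].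

(* Main.v *)
(** The Skeleton nodes at the top of [+s] and [-t] preserve nonempty joins
    (resp. meets) in each coordinate, so [s <= t] holds iff, for all generators
    put in the holes below the skeleton, solvability of the resulting system of
    constraints [w <= alpha(v)] (resp. [alpha(v) <= w]) entails one inequality
    without variables.  Each constraint is stable under meets of valuations (in
    the order twisted by epsilon) of its critical leaves, because the branches to
    these run through PIA nodes.  Hence a solvable system has a least solution,
    and its value at [p] only depends on its values at the Omega-smaller
    variables, so that it is computed in finitely many steps.

    Elementarity: over a perfect algebra the generators are the completely
    join-irreducibles [j] and the [kappa j], and every step is first-order
    definable in the dual frame.

    Canonicity: over the canonical extension the generators are the closed and
    open elements.  The least solution is then closed (in the twisted order), and
    compactness turns it into a solution with values in [A], where the
    inequality is valid.  That the extended operations preserve nonempty joins or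
    meets follows from an adjunction argument which uses compactness only. *)
Require Import Defs.
From mathcomp Require Import all_boot all_order.
From mathcomp Require Import boolp classical_sets cardinality.

Set Implicit Arguments.
Unset Strict Implicit.
Unset Printing Implicit Defensive.

Import Order.TTheory.
Local Open Scope classical_set_scope.
Local Open Scope order_scope.

(** * Signed orders and signed bounds *)

(** Solvability of the constraints quantifies over valuations and is thus second-order; it is
    replaced by the test whether one computed valuation, [minval], is a solution. That valuation
    arises from tests of a single value at a single variable, which is why constraints are read with
    two valuations. The operations preserve only nonempty joins or meets, so approximating sets must
    be nonempty and the bottom (or top) has to be allowed as a generator; in the dual frame this is
    the choice of the coordinates [P] of a relation. Every notion carries a sign, so that a
    statement and its order dual are proved at once: [sle b], [sSup b], [sbot b], [sjoin b] are the
    order, supremum, bottom and join of the order reversed when [b] holds, and the meet of that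
    order is [sjoin (~~ b)]. Terms mix sigma and pi extensions; this is harmless because both agree
    on closed and on open tuples. *)

Definition sle d (T : porderType d) (b : bool) (x y : T) : bool :=
  if b then y <= x else x <= y.

Definition sSup d (T : tbLatticeType d) (b : bool) (X : set T) : T :=
  if b then Inf X else Sup X.

Definition setc (I : eqType) (T : Type) (x : I -> T) (j : I) (y : T) : I -> T :=
  fun i => if i == j then y else x i.

Section SignedOrder.
Context d (T : porderType d).
Implicit Types (b : bool) (x y z : T) (X Y : set T).

Lemma sle_refl b x : sle b x x.
Proof. by case: b => /=. Qed.

Lemma sle_trans b y x z : sle b x y -> sle b y z -> sle b x z.
Proof. by case: b => /= h1 h2; [exact: le_trans h2 h1|exact: le_trans h1 h2]. Qed.

Lemma sle_anti b x y : sle b x y -> sle b y x -> x = y.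
Proof. by case: b => /= h1 h2; apply/le_anti; rewrite h1 h2. Qed.

Lemma sleN b x y : sle (~~ b) x y = sle b y x.
Proof. by case: b. Qed.

Lemma boundsP b X x :
  bounds b X x <-> forall y, sle b x y <-> (forall z, X z -> sle b z y).
Proof.
case: b => /=; split.
- case=> h1 h2 y; split => [yx z /h1 xz|]; first exact: le_trans yx xz.
  exact: h2.
- by move=> h; split => [z Xz|z hz]; [exact: (h x).1|apply/h].
- case=> h1 h2 y; split => [yx z /h1 xz|]; first exact: le_trans xz yx.
  exact: h2.
- by move=> h; split => [z Xz|z hz]; [exact: (h x).1|apply/h].
Qed.

Lemma bounds_ub b X x y : bounds b X x -> X y -> sle b y x.
Proof. by move=> /boundsP/(_ x)[/(_ (sle_refl b x)) h _] /h. Qed.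

Lemma bounds_le b X x y :
  bounds b X x -> (forall z, X z -> sle b z y) -> sle b x y.
Proof. by move=> /boundsP/(_ y)[]. Qed.

Lemma boundsI b X x :
  (forall z, X z -> sle b z x) ->
  (forall y, (forall z, X z -> sle b z y) -> sle b x y) -> bounds b X x.
Proof.
move=> h1 h2; apply/boundsP => y; split=> [xy z /h1 zx|]; last exact: h2.
exact: sle_trans zx xy.
Qed.

Lemma bounds_pair b x y : sle b x y -> bounds b [set x; y] y.
Proof.
move=> xy; apply/boundsP => z; split=> [yz w [->|->] //|h].
  exact: sle_trans xy yz.
by apply: h; right.
Qed.

Lemma bounds1 b x : bounds b [set x] x.
Proof. by apply/boundsP => z; split=> [h w ->|]//; apply. Qed.

End SignedOrder.

Section SignedSup.
Context d (T : tbLatticeType d).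
Implicit Types (b : bool) (x y z : T) (X Y : set T).

Lemma sSup_bounds b X : complete T -> bounds b X (sSup b X).
Proof.
move=> /(_ X)[hS hI]; case: b => /=.
  rewrite /Inf /infimum; case: ifPn => [/eqP->|_].
    by split => [z //|z _]; exact: lex1.
  by case: hI => x hx; apply: xgetI hx.
rewrite /Sup /supremum; case: ifPn => [/eqP->|_].
  by split => [z //|z _]; exact: le0x.
by case: hS => x hx; apply: xgetI hx.
Qed.

Lemma bounds_sSup b X x : complete T -> bounds b X x -> sSup b X = x.
Proof.
move=> cT Xx; apply: (@sle_anti _ _ b).
  by apply: bounds_le (sSup_bounds b X cT) _ => z /(bounds_ub Xx).
by apply: bounds_le Xx _ => z /(bounds_ub (sSup_bounds b X cT)).
Qed.

Lemma sle_sSup b X x : complete T -> X x -> sle b x (sSup b X).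
Proof. by move=> cT Xx; apply: bounds_ub (sSup_bounds b X cT) Xx. Qed.

Lemma sSup_le b X x :
  complete T -> (forall z, X z -> sle b z x) -> sle b (sSup b X) x.
Proof. by move=> cT; apply: bounds_le (sSup_bounds b X cT). Qed.

Definition sbot b : T := if b then \top else \bot.

Lemma sbot_le b x : sle b (sbot b) x.
Proof. by case: b => /=; [exact: lex1|exact: le0x]. Qed.

Lemma sle_sbotN b x : sle b x (sbot (~~ b)).
Proof. by case: b => /=; [exact: le0x|exact: lex1]. Qed.

Definition sjoin b x y := if b then Order.meet x y else Order.join x y.

Lemma sle_joinl b x y : sle b x (sjoin b x y).
Proof. by case: b => /=; [exact: leIl|exact: leUl]. Qed.

Lemma sle_joinr b x y : sle b y (sjoin b x y).
Proof. by case: b => /=; [exact: leIr|exact: leUr]. Qed.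

Lemma sjoin_le b x y z : sle b (sjoin b x y) z = sle b x z && sle b y z.
Proof. by case: b => /=; [exact: lexI|exact: leUx]. Qed.

Lemma sle_meetl b x y : sle b (sjoin (~~ b) x y) x.
Proof. by rewrite -sleN sle_joinl. Qed.

Lemma sle_meetr b x y : sle b (sjoin (~~ b) x y) y.
Proof. by rewrite -sleN sle_joinr. Qed.

Lemma sle_meet b x y z : sle b z (sjoin (~~ b) x y) = sle b z x && sle b z y.
Proof. by rewrite -sleN sjoin_le !sleN. Qed.

Lemma bounds_join b x y : bounds b [set x; y] (sjoin b x y).
Proof.
apply/boundsP => z; rewrite sjoin_le; split.
  by case/andP=> ? ? w [->|->].
by move=> h; rewrite !h //; [right|left].
Qed.

End SignedSup.

Lemma ord2P (P : 'I_2 -> Prop) : P ord0 -> P ord_max -> forall j, P j.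
Proof.
move=> h0 h1 j; case: (eqVneq j ord0) => [->//|j0].
suff -> : j = ord_max by [].
by apply: val_inj; case: j j0 => -[|[|]].
Qed.

Section SetC.
Context (I : eqType) (T : Type).
Implicit Types (x : I -> T) (j : I) (y : T).

Lemma setcE x j y : setc x j y j = y.
Proof. by rewrite /setc eqxx. Qed.

Lemma setcNE x j y i : i != j -> setc x j y i = x i.
Proof. by rewrite /setc => /negbTE->. Qed.

Lemma setc_id x j : setc x j (x j) = x.
Proof. by apply/funext => i; rewrite /setc; case: eqP => [->|]. Qed.

End SetC.

(** * Preservation of bounds by the nodes of terms *)

Definition pairs (T : Type) : set (set T) := [set X | exists x y, X = [set x; y]].
Definition inhabited_sets (T : Type) : set (set T) := [set X | X !=set0].

Section NodePreservation.
Context (S : signature) (L : lang) d (A : tbDistrLatticeType d).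
Context (O : operations S L A).

(** A PIA node is Skeleton at the opposite sign ([PIA_skeletonN]), so this one notion serves both
    halves of a branch. [Q] consists of pairs for arbitrary algebras and of all nonempty sets for
    perfect algebras and canonical extensions. *)
Definition node_preserving (Q : set (set A)) : Prop :=
  forall (nd : node L) (b : bool), skeleton b nd ->
  forall (x : 'I_(node_arity S nd) -> A) j X c, Q X ->
    bounds (b (+) node_otype j) X c ->
    bounds b [set node_eval O (setc x j y) | y in X] (node_eval O (setc x j c)).

Lemma finfun_setc (o : opsym) (x : 'I_(arity S o) -> A) j y :
  (finfun (setc x j y) : epow (otype S o) A) =
  upd (finfun x : epow (otype S o) A) j y.
Proof. by apply/ffunP => i; rewrite !ffunE. Qed.

(** The second hypothesis is the frame law, or its order dual, for sets in [Q]. It settles [+and],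
    [-or] and the antecedent of an implication; the consequent follows from residuation alone. *)
Lemma node_preservingP (Q : set (set A)) :
  Q `<=` @inhabited_sets A ->
  (forall b a X c z, Q X -> bounds b X c ->
     (forall y, X y -> sle b (sjoin (~~ b) y a) z) ->
     sle b (sjoin (~~ b) c a) z) ->
  (forall o, preserves (is_meet_op o) Q (opn O o)) ->
  (forall (har : is_HAR L) (a b c : A),
     (Order.meet c a <= b) = (c <= imp O har a b)) ->
  node_preserving Q.
Proof.
move=> Q0 frame opP impP nd b.
have opnP (o : opsym) (x : 'I_(arity S o) -> A) j X c : Q X ->
    bounds (is_meet_op o (+) otype S o j) X c ->
    bounds (is_meet_op o) [set node_eval O (nd := @NOp L o) (setc x j y) | y in X]
      (node_eval O (nd := @NOp L o) (setc x j c)).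
  move=> QX Xc; rewrite /= finfun_setc.
  rewrite (_ : [set _ | y in X] =
    [set opn O o (upd (finfun x : epow (otype S o) A) j y) | y in X]).
    by apply: opP => //; rewrite addbC.
  by congr image; apply/funext => y; rewrite finfun_setc.
have joinP b' (f : A -> A) (a : A) X c : (forall y, f y = sjoin b' y a) ->
    Q X -> bounds b' X c -> bounds b' [set f y | y in X] (f c).
  move=> fE QX Xc; apply: boundsI.
    move=> _ [y Xy <-]; rewrite !fE sjoin_le sle_joinr andbT.
    exact: sle_trans (bounds_ub Xc Xy) (sle_joinl _ _ _).
  move=> z h; rewrite fE sjoin_le; apply/andP; split.
    apply: bounds_le Xc _ => y Xy.
    have := h _ (ex_intro2 _ _ _ Xy erefl).
    by rewrite fE sjoin_le => /andP[].
  (* Nonemptiness of [X] is what bounds the fixed argument [a] by [z]. *)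
  have [y Xy] := Q0 _ QX; have := h _ (ex_intro2 _ _ _ Xy erefl).
  by rewrite fE sjoin_le => /andP[].
have meetP b' (f : A -> A) (a : A) X c : (forall y, f y = sjoin (~~ b') y a) ->
    Q X -> bounds b' X c -> bounds b' [set f y | y in X] (f c).
  move=> fE QX Xc; apply: boundsI.
    move=> _ [y Xy <-]; rewrite !fE sle_meet sle_meetr andbT.
    exact: sle_trans (sle_meetl _ _ _) (bounds_ub Xc Xy).
  move=> z h; rewrite fE; apply: (frame _ _ X) => // y Xy; rewrite -fE.
  by apply: h; exists y.
case: nd => [|| | |har|o]; case: b => //=.
- move=> _ x j X c QX; elim/ord2P: j => Xc.
    exact: (joinP true _ (x ord_max)).
  by apply: (joinP true _ (x ord0)) => // y; exact: meetC.
- move=> _ x j X c QX; elim/ord2P: j => Xc.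
    exact: (meetP false _ (x ord_max)).
  by apply: (meetP false _ (x ord0)) => // y; exact: meetC.
- move=> _ x j X c QX; elim/ord2P: j => Xc.
    exact: (meetP true _ (x ord_max)).
  by apply: (meetP true _ (x ord0)) => // y; exact: joinC.
- move=> _ x j X c QX; elim/ord2P: j => Xc.
    exact: (joinP false _ (x ord_max)).
  by apply: (joinP false _ (x ord0)) => // y; exact: joinC.
- move=> _ x j X c QX; elim/ord2P: j => Xc; apply: (@boundsI _ _ true) => /=.
  + move=> _ [y Xy <-] /=; rewrite -impP.
    apply: le_trans (leI2 (lexx _) (bounds_ub Xc Xy)) _.
    by rewrite impP.
  + move=> z h; rewrite -impP meetC; apply: (frame false z X) => // y Xy /=.
    by rewrite meetC impP; apply: h; exists y.
  + move=> _ [y Xy <-] /=; rewrite -impP.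
    by apply: le_trans (bounds_ub Xc Xy); rewrite impP.
  + move=> z h; rewrite -impP; apply: (bounds_le (b := true) Xc) => y Xy /=.
    by rewrite impP; apply: h; exists y.
- by case: o => // _ x j X c; exact: (opnP _ x j X c).
- by case: o => // _ x j X c; exact: (opnP _ x j X c).
Qed.

End NodePreservation.

Lemma coordinate_ind n (T : Type) (P : ('I_n -> T) -> Prop) (x y : 'I_n -> T) :
  (forall z j, P z -> P (setc z j (y j))) -> P x -> P y.
Proof.
move=> h Px.
have {h} h m : (m <= n)%N -> P (fun i : 'I_n => if (i < m)%N then y i else x i).
  elim: m => [|m IHm] mn; first by rewrite (_ : (fun _ => _) = x) //; exact/funext.
  have := h _ (Ordinal mn) (IHm (ltnW mn)); congr P; apply/funext => i.
  rewrite /setc; case: (eqVneq i (Ordinal mn)) => [->|ne] /=; first by rewrite ltnSn.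
  rewrite [(i < m.+1)%N]ltnS [(i <= m)%N]leq_eqVlt; suff /negbTE-> : nat_of_ord i != m by [].
  by apply: contra ne => /eqP e; apply/eqP/val_inj.
have := h n (leqnn n); congr P; apply/funext => i.
by rewrite ltn_ord.
Qed.

Section NodeMono.
Context (S : signature) (L : lang) d (A : tbDistrLatticeType d).
Context (O : operations S L A) (Q : set (set A)).
Hypotheses (Qpairs : @pairs A `<=` Q) (Opr : node_preserving O Q).

(** Monotonicity is preservation of the bound of a comparable pair, one coordinate at a time. Except
    for constants, a node is Skeleton at some sign; the other sign gives the order dual
    statement. *)
Lemma node_mono (nd : node L) b (x y : 'I_(node_arity S nd) -> A) :
  (forall j, sle (b (+) node_otype j) (x j) (y j)) ->
  sle b (node_eval O x) (node_eval O y).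
Proof.
have step c (x' y' : 'I_(node_arity S nd) -> A) : skeleton c nd ->
    (forall j, sle (c (+) node_otype j) (x' j) (y' j)) ->
    sle c (node_eval O x') (node_eval O y').
  move=> sk xy.
  pose P z := (forall j, sle (c (+) node_otype j) (z j) (y' j)) /\
              sle c (node_eval O x') (node_eval O z).
  have [] // : P y'.
  apply: (@coordinate_ind _ _ P x'); last by split=> //; exact: sle_refl.
  move=> z j [zy xz]; split.
    by move=> i; rewrite /setc; case: eqP => [->|_ //]; exact: sle_refl.
  apply: sle_trans xz _; rewrite -{1}(setc_id z j).
  apply: bounds_ub (Opr sk z (Qpairs _) (bounds_pair (zy j))) _.
    by exists (z j), (y' j).
  by exists (z j) => //; left.
have [[c sk] xy|no xy] := pselect (exists c, skeleton c nd); last first.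
  have : node_arity S nd = 0%N by case: nd no {x y xy step} => //= [||har|[]] [];
    by [exists true|exists false].
  by move=> n0; rewrite (_ : x = y) ?sle_refl//; apply/funext => j;
    have := ltn_ord j; move: (nat_of_ord j) => k; rewrite n0.
move: xy; case: (eqVneq c b) => [<-|cb] xy; first exact: step.
case: c sk cb => sk; case: b xy => xy // _.
- by rewrite -[false]/(~~ true) sleN; apply: step => // j; rewrite -sleN -addNb.
- by rewrite -[true]/(~~ false) sleN; apply: step => // j; rewrite -sleN -addNb.
Qed.

End NodeMono.

(** * The skeleton of a signed tree and its holes *)

Section SignedTrees.
Context (S : signature) (L : lang) (N : nat).
Implicit Types (s : term S L N) (b : bool) (Omega : rel 'I_N) (eps : 'I_N -> bool).

Definition pia_tree Omega eps b s : Prop :=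
  forall P i b', branch b s P i b' -> critical eps i b' ->
    all (fun st => PIA (st_sign st) (st_node st)) P /\
    forall st, List.In st P -> SRR (st_sign st) (st_node st) ->
      SRR_ok Omega eps i st.

Lemma PIA_skeletonN b (nd : node L) : PIA b nd -> skeleton (~~ b) nd.
Proof. by case: b; case: nd => // -[]. Qed.

Lemma inductive_tree_child Omega eps b nd
    (args : 'I_(node_arity S nd) -> term S L N) j :
  inductive_tree Omega eps b (Node args) ->
  inductive_tree Omega eps (b (+) node_otype j) (args j).
Proof.
move=> ind P i b' br cr.
have [P2 [P1 [E pia sk ok]]] := ind _ _ _ (branch_node br) cr.
case: P2 E sk => [|st P2] /= E sk.
  exists [::], P; rewrite -E in pia ok; split=> //=; first by case/andP: pia.
  by move=> st Pst; apply: ok; right.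
case: E => _ ->; exists P2, P1; split=> //.
by case/andP: sk.
Qed.

Lemma inductive_pia_tree Omega eps b s :
  (if s is Node nd _ then ~~ skeleton b nd else true) ->
  inductive_tree Omega eps b s -> pia_tree Omega eps b s.
Proof.
move=> nsk ind P i b' br cr.
have [P2 [P1 [E pia sk ok]]] := ind _ _ _ br cr.
suff P20 : P2 = [::] by rewrite E P20; split.
case: br nsk E => {P i b' cr ok}[b0 i|b0 nd args j P i b' br] nsk E.
  by case: P2 E sk.
case: P2 E sk => // st P2 [<- _] /=.
by rewrite (negbTE nsk).
Qed.

Lemma pia_tree_child Omega eps b nd
    (args : 'I_(node_arity S nd) -> term S L N) j :
  pia_tree Omega eps b (Node args) ->
  pia_tree Omega eps (b (+) node_otype j) (args j).
Proof.
move=> pia P i b' br cr; have [/=/andP[_ h1] h2] := pia _ _ _ (branch_node br) cr.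
by split=> // st Pst; apply: h2; right.
Qed.

Lemma branch_sign b s P i b' c : branch b s P i b' ->
  exists P', branch (c (+) b) s P' i (c (+) b').
Proof.
elim=> [b0 i0|b0 nd args j P0 i0 b0' _ [P' IH]]; first by exists [::]; constructor.
exists (Step (c (+) b0) args j :: P'); constructor.
by rewrite -addbA.
Qed.

Lemma branch_occurs b s P i b' : branch b s P i b' -> occurs i s.
Proof.
by move=> /(branch_sign b)[P']; rewrite addbb => br; exists P', (b (+) b').
Qed.

(** The skeleton is taken as large as possible: nodes that are both Skeleton and PIA, such as [+and]
    and [+or], count as Skeleton. The root of a hole is then never Skeleton, which forces [P2] to be
    empty on critical branches inside it. Finiteness matters because holes become quantified
    variables of a sentence. *)
Fixpoint holes b s : finType :=
  match s with
  | Var _ => unit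
  | @Node _ _ _ nd args =>
      if skeleton b nd then
        ({j : 'I_(node_arity S nd) & holes (b (+) node_otype j) (args j)} : finType)
      else unit
  end.

Fixpoint hole b s : holes b s -> bool * term S L N :=
  match s return holes b s -> bool * term S L N with
  | Var _ => fun=> (b, s)
  | @Node _ _ _ nd args =>
      if skeleton b nd as c
      return Finite.sort (if c then
        ({j : 'I_(node_arity S nd) & holes (b (+) node_otype j) (args j)} : finType)
      else unit) -> bool * term S L N
      then fun h => hole (projT2 h)
      else fun=> (b, s)
  end.

Section SkeletonEval.
Context d (A : tbDistrLatticeType d) (O : operations S L A).

Fixpoint sk_eval b s : (holes b s -> A) -> A :=
  match s return (holes b s -> A) -> A with
  | Var _ => fun w => w tt
  | @Node _ _ _ nd args =>
      if skeleton b nd as c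
      return (Finite.sort (if c then
        ({j : 'I_(node_arity S nd) & holes (b (+) node_otype j) (args j)} : finType)
      else unit) -> A) -> A
      then fun w => node_eval O (fun j => sk_eval (fun h => w (existT _ j h)))
      else fun w => w tt
  end.

End SkeletonEval.

Lemma hole_pia_tree Omega eps b s (h : holes b s) :
  inductive_tree Omega eps b s -> pia_tree Omega eps (hole h).1 (hole h).2.
Proof.
elim: s b h => [i|nd args IH] b /= h ind; first exact: inductive_pia_tree.
have pia : ~~ skeleton b nd -> pia_tree Omega eps b (Node args).
  by move=> nsk; apply: inductive_pia_tree.
move: h pia; case: (skeleton b nd) => [[j h] _|_ pia] /=; last exact: pia.
exact: IH (inductive_tree_child ind).
Qed.

Section SkeletonTheory.
Context d (A : tbDistrLatticeType d) (O : operations S L A).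

Lemma sk_eval_hole b s (v : 'I_N -> A) :
  sk_eval O (fun h : holes b s => eval O v (hole h).2) = eval O v s.
Proof.
elim: s b => [//|nd args IH] b /=.
case: (skeleton b nd) => //=; congr node_eval; apply/funext => j.
exact: IH.
Qed.

Lemma sk_eval_mono Q b s (w w' : holes b s -> A) :
  @pairs A `<=` Q -> node_preserving O Q ->
  (forall h, sle (hole h).1 (w h) (w' h)) -> sle b (sk_eval O w) (sk_eval O w').
Proof.
move=> Qp pr; elim: s b w w' => [i|nd args IH] b /= w w'; first exact.
move: w w'; case: (skeleton b nd) => w w' /= h; last exact: (h tt).
by apply: node_mono Qp pr _ _ _ _ _ => j; apply: IH => h1; exact: (h (existT _ j h1)).
Qed.

Lemma node_approx (nd : node L) b (x : 'I_(node_arity S nd) -> A)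
    (X : 'I_(node_arity S nd) -> set A) z :
  node_preserving O (@inhabited_sets A) -> skeleton b nd ->
  (forall j, X j !=set0) -> (forall j, bounds (b (+) node_otype j) (X j) (x j)) ->
  (forall y, (forall j, X j (y j)) -> sle b (node_eval O y) z) ->
  sle b (node_eval O x) z.
Proof.
move=> pr sk X0 Xx h.
have {}X0 j : exists y, X j y by exact: X0.
have [c Xc] := choice X0.
(* Coordinates below [m] still hold the exact values [x], the others hold members of [X]; the goal
   is [m] equal to the arity, the hypothesis is [m = 0]. *)
suff H m (y : 'I_(node_arity S nd) -> A) :
    (forall j : 'I_(node_arity S nd), (j < m)%N -> y j = x j) ->
    (forall j : 'I_(node_arity S nd), (m <= j)%N -> X j (y j)) ->
    sle b (node_eval O y) z.
  by apply: (H (node_arity S nd)) => // j; rewrite leqNgt ltn_ord.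
elim: m y => [|m IHm] y hx hX; first by apply: h => j; exact: hX.
have [mn|nm] := ltnP m (node_arity S nd); last first.
  apply: IHm => j jm; first by apply: hx; rewrite ltnW.
  by have := leq_trans (ltn_ord j) (leq_trans nm jm); rewrite ltnn.
pose j0 := Ordinal mn.
rewrite -(setc_id y j0) hx ?ltnSn//.
apply: bounds_le (pr _ _ sk y j0 (X j0) (x j0) _ (Xx j0)) _; first by exists (c j0).
move=> _ [a Xa <-]; apply: IHm => j jm.
  rewrite setcNE ?hx//; first exact: ltnW.
  by apply: contraTneq jm => ->; rewrite ltnn.
rewrite /setc; case: eqP => [->//|/eqP ne]; apply: hX.
rewrite ltn_neqAle jm andbT; apply: contra ne => /eqP e.
exact/eqP/val_inj.
Qed.

(** The generators depend on the sign of the hole: positive holes are approximated by joins,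
    negative ones by meets. *)
Lemma sk_eval_approx (G : bool -> set A) b s (x : holes b s -> A) z :
  node_preserving O (@inhabited_sets A) ->
  (forall b a, exists2 X, X !=set0 /\ X `<=` G b & bounds b X a) ->
  (forall w, (forall h, G (hole h).1 (w h)) ->
     (forall h, sle (hole h).1 (w h) (x h)) -> sle b (sk_eval O w) z) ->
  sle b (sk_eval O x) z.
Proof.
move=> pr Ggen.
have leaf b' y z' : (forall a, G b' a -> sle b' a y -> sle b' a z') -> sle b' y z'.
  move=> h; have [X [_ XG] XXy] := Ggen b' y.
  by apply: (bounds_le XXy) => a Xa; exact: h (XG _ Xa) (bounds_ub XXy Xa).
elim: s b x z => [i|nd args IH] b /= x z H.
  by apply: leaf => a Ga ax; apply: (H (fun=> a)) => -[].
move: x H; case skE: (skeleton b nd) => /= x H; last first.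
  by apply: leaf => a Ga ax; apply: (H (fun=> a)) => -[].
pose T (j : 'I_(node_arity S nd)) : finType := holes (b (+) node_otype j) (args j).
pose W j : set (T j -> A) := [set w | (forall h, G (hole h).1 (w h)) /\
  forall h, sle (hole h).1 (w h) (x (existT _ j h))].
apply: (node_approx (X := fun j => [set sk_eval O w | w in W j])) => //.
- move=> j; have Wj (h : T j) : exists a, G (hole h).1 a /\ sle (hole h).1 a (x (existT _ j h)).
    have [X [[a Xa] XG] Xx] := Ggen (hole h).1 (x (existT _ j h)).
    by exists a; split; [exact: XG|exact: bounds_ub Xx Xa].
  have [w hw] := choice Wj; exists (sk_eval O w), w => //.
  by split=> h; case: (hw h).
- move=> j; apply: boundsI.
    move=> _ [w [_ wx] <-]; apply: sk_eval_mono pr _ => //.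
    by move=> X [a [a' ->]]; exists a; left.
  by move=> y hy; apply: IH => w Gw wx; apply: hy; exists w.
- move=> y hy.
  have [w hw] : exists w : {j & T j} -> A, forall j,
      W j (fun h => w (existT _ j h)) /\ sk_eval O (fun h => w (existT _ j h)) = y j.
    have hy' j : exists w, W j w /\ sk_eval O w = y j by have [w] := hy j; exists w.
    exists (fun h => sval (cid (hy' (tag h))) (tagged h)) => j /=.
    exact: (svalP (cid (hy' j))).
  rewrite (_ : y = fun j => sk_eval O (fun h => w (existT _ j h))).
    by apply: H => -[j h]; have [[h1 h2] _] := hw j; [exact: h1|exact: h2].
  by apply/funext => j; have [_ <-] := hw j.
Qed.

End SkeletonTheory.

End SignedTrees.

(** * Minimal valuations *)

Section CriticalSplit.
Context (S : signature) (L : lang) (N : nat) (eps : 'I_N -> bool).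
Implicit Types (s : term S L N) (b : bool).

(* Two valuations separate the occurrences that bound a variable (critical    *)
(* leaves, read in u) from those at which only its minimality matters.        *)
Fixpoint eval2 d (A : tbDistrLatticeType d) (O : operations S L A)
    (b : bool) (u v : 'I_N -> A) s : A :=
  match s with
  | Var i => if critical eps i b then u i else v i
  | Node nd args =>
      node_eval O (fun j => eval2 O (b (+) node_otype j) u v (args j))
  end.

Context d (A : tbDistrLatticeType d) (O : operations S L A).

Lemma eval2_diag b v s : eval2 O b v v s = eval O v s.
Proof.
elim: s b => [i|nd args IH] b /=; first by case: ifP.
by congr node_eval; apply/funext => j; exact: IH.
Qed.

Lemma eval2_eq b u v u' v' s :
  (forall P i b', branch b s P i b' ->
     if critical eps i b' then u i = u' i else v i = v' i) ->
  eval2 O b u v s = eval2 O b u' v' s.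
Proof.
elim: s b => [i|nd args IH] b /= h.
  by have := h _ _ _ (branch_leaf S L b i); case: ifP.
congr node_eval; apply/funext => j; apply: IH => P i b' br.
exact: h (branch_node br).
Qed.

Lemma eval2_mono Q b u v u' v' s :
  @pairs A `<=` Q -> node_preserving O Q ->
  (forall i, sle (eps i) (u i) (u' i)) -> (forall i, sle (eps i) (v' i) (v i)) ->
  sle b (eval2 O b u v s) (eval2 O b u' v' s).
Proof.
move=> Qp pr uu vv; elim: s b => [i|nd args IH] b /=; last first.
  by apply: node_mono Qp pr _ _ _ _ _ => j; exact: IH.
rewrite /critical; case: eqP => [->//|/eqP ne].
by rewrite (_ : b = ~~ eps i) ?sleN//; case: b (eps i) ne => -[].
Qed.

End CriticalSplit.

Lemma ord_arity1 n : n = 1%N -> forall k j : 'I_n, k = j.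
Proof. by move=> -> k j; rewrite !ord1. Qed.

Lemma branch_inv S L N b nd (args : 'I_(node_arity S nd) -> term S L N) P i b' :
  branch b (Node args) P i b' ->
  exists j P', branch (b (+) node_otype j) (args j) P' i b'.
Proof.
set s := Node args => br.
(* Matching on the term exposes its dependent arguments without equalities between dependent
   pairs. *)
suff : match s return Prop with
  | Var _ => True
  | Node _ args => exists j P', branch (b (+) node_otype j) (args j) P' i b'
  end by [].
by case: br => // b0 nd0 args0 j P0 i0 b0' br; exists j, P0.
Qed.

Lemma pairs_inhabited (T : Type) : @pairs T `<=` @inhabited_sets T.
Proof. by move=> X [a [a' ->]]; exists a; left. Qed.

Section MinimalValuation.
Context (S : signature) (L : lang) (N : nat).
Context (Omega : rel 'I_N) (eps : 'I_N -> bool).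
Context d (C : tbDistrLatticeType d) (O : operations S L C).
Hypotheses (cC : complete C) (Opr : node_preserving O (@inhabited_sets C)).
Implicit Types (s : term S L N) (b : bool) (u v : 'I_N -> C).

Local Notation eval2 := (eval2 eps O).

Let Cmono (nd : node L) b (x y : 'I_(node_arity S nd) -> C) :
  (forall j, sle (b (+) node_otype j) (x j) (y j)) ->
  sle b (node_eval O x) (node_eval O y).
Proof. exact: node_mono (@pairs_inhabited C) Opr _ _ _ _. Qed.

Let eval2_Cmono b u v u' v' s :
  (forall i, sle (eps i) (u i) (u' i)) -> (forall i, sle (eps i) (v' i) (v i)) ->
  sle b (eval2 b u v s) (eval2 b u' v' s).
Proof. exact: eval2_mono (@pairs_inhabited C) Opr. Qed.

(* Binary SMP nodes split componentwise; at the other PIA nodes only the      *)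
(* coordinate of the critical branch depends on critical leaves, and there    *)
(* the node preserves bounds as a skeleton node of the opposite sign.         *)
Lemma pia_node_cases b nd (args : 'I_(node_arity S nd) -> term S L N) P i b' j :
  pia_tree Omega eps b (Node args) ->
  branch (b (+) node_otype j) (args j) P i b' -> critical eps i b' ->
  (forall (x : 'I_(node_arity S nd) -> C) z,
      sle b z (node_eval O x) <-> forall k, sle (b (+) node_otype k) z (x k)) \/
  skeleton (~~ b) nd /\
  forall k, k != j -> forall P' i' c,
    branch (b (+) node_otype k) (args k) P' i' c ->
    ~~ critical eps i' c /\ Omega i' i.
Proof.
move=> pia br cr; have [/=/andP[h _] ok] := pia _ _ _ (branch_node br) cr.
have [srr|nsrr] := boolP (SRR b nd).
  right; split; first exact: PIA_skeletonN.
  move=> k kj P' i' c br'.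
  have [/= _ /(_ _ kj)[agr om]] := ok _ (or_introl erefl) srr.
  split; last by apply: om; exact: branch_occurs br'.
  have := agr _ _ _ br'; rewrite /critical => /eqP ->.
  by case: (eps i').
move: (h); rewrite /PIA (negbTE nsrr) orbF => smp.
have lat (c : bool) (x : 'I_2 -> C) z :
    sle c z (sjoin (~~ c) (x ord0) (x ord_max)) <->
    forall k, sle (c (+) false) z (x k).
  rewrite addbF sle_meet; split; first by case/andP=> h0 h1; elim/ord2P.
  by move=> hx; rewrite !hx.
case: nd args j pia br ok h nsrr smp => [|| | |har|o] args j pia br ok h nsrr smp.
- by case: b smp {pia br ok h nsrr}.
- by case: b smp {pia br ok h nsrr}.
- by left; case: b smp {pia br ok h nsrr} => // _ x z; exact: (lat false).
- by left; case: b smp {pia br ok h nsrr} => // _ x z; exact: (lat true).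
- by case: b smp {pia br ok h nsrr}.
- right; split; first exact: PIA_skeletonN.
  have o1 : arity S o = 1%N by case: b smp {pia br ok h nsrr}; case: o {args j}.
  by move=> k; case/eqP; exact: (@ord_arity1 _ o1).
Qed.

(** This is the stability of constraints under meets in the critical leaves. Side subtrees of an SRR
    node contain no critical leaves, so a single coordinate varies with [u'] and the node preserves
    its bound. *)
Lemma eval2_bounds b s (U : set ('I_N -> C)) u v z :
  pia_tree Omega eps b s -> U !=set0 ->
  (forall i, bounds (~~ eps i) [set u' i | u' in U] (u i)) ->
  (forall u', U u' -> sle b z (eval2 b u' v s)) -> sle b z (eval2 b u v s).
Proof.
move=> + [u0 Uu0] Uu; elim: s b z => [i|nd args IH] b z pia h.
  have := h _ Uu0; rewrite /= /critical; case: eqP => // bi _.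
  rewrite -sleN; apply: bounds_le (_ : bounds (~~ b) _ (u i)) _.
    by rewrite bi; exact: Uu.
  by move=> _ [u' Uu' <-]; have := h _ Uu'; rewrite /= /critical bi eqxx sleN.
have [|no] := pselect (exists P i b',
    branch b (Node args) P i b' /\ critical eps i b'); last first.
  (* Without critical leaves the value does not depend on [u], so any member of [U] will do. *)
  rewrite (@eval2_eq _ _ _ _ _ _ O b u v u0 v); first exact: h.
  by move=> P i b' br; case: ifP => // cr; case: no; exists P, i, b'.
case=> P [i [b' [/branch_inv[j [P' br]] cr]]].
have IHk k z' : (forall u', U u' ->
    sle (b (+) node_otype k) z' (eval2 (b (+) node_otype k) u' v (args k))) ->
    sle (b (+) node_otype k) z' (eval2 (b (+) node_otype k) u v (args k)).
  by apply: IH; exact: pia_tree_child.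
have [smp|[sk other]] := pia_node_cases pia br cr.
  by rewrite smp => k; apply: IHk => u' Uu'; move: (h _ Uu'); rewrite /= smp.
pose x k := eval2 (b (+) node_otype k) u v (args k).
have xE u' : (fun k => eval2 (b (+) node_otype k) u' v (args k)) =
    setc x j (eval2 (b (+) node_otype j) u' v (args j)).
  apply/funext => k; rewrite /setc; case: eqP => [->//|/eqP kj].
  by apply: eval2_eq => P1 i1 c /(other _ kj)[/negbTE->].
rewrite /= xE -sleN.
pose Y := [set eval2 (b (+) node_otype j) u' v (args j) | u' in U].
apply: bounds_le (Opr sk x (X := Y) (j := j) (c := x j) _ _) _.
- by exists (eval2 (b (+) node_otype j) u0 v (args j)), u0.
- rewrite addNb; apply: boundsI.
    move=> _ [u' Uu' <-]; rewrite sleN; apply: eval2_Cmono => k; last exact: sle_refl.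
    by rewrite -sleN; apply: bounds_ub (Uu k) _; exists u'.
  move=> y hy; rewrite sleN; apply: IHk => u' Uu'; rewrite -sleN.
  by apply: hy; exists u'.
- move=> _ [_ [u' Uu' <-] <-]; rewrite sleN.
  by have := h _ Uu'; rewrite /= xE.
Qed.

(* Below p, a critical branch to p only depends on the Omega-smaller          *)
(* variables, through the side trees of its SRR nodes.                        *)
Lemma eval2_indep b s p c u v v' z :
  pia_tree Omega eps b s -> (forall q, Omega q p -> v q = v' q) ->
  sle b z (eval2 b (setc u p c) v s) -> sle b z (eval2 b u v' s) ->
  sle b z (eval2 b (setc u p c) v' s).
Proof.
move=> + vv; elim: s b z => [i|nd args IH] b z pia /=.
  by rewrite /critical; case: eqP.
move=> h h'.
have [|no] := pselect (exists P b',
    branch b (Node args) P p b' /\ critical eps p b'); last first.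
  rewrite -[node_eval O _]/(eval2 b (setc u p c) v' (Node args)).
  rewrite (@eval2_eq _ _ _ _ _ _ O b _ _ u v')//.
  move=> P i b' br; case: ifP => // cr; rewrite setcNE//.
  by apply: contra_notN no => /eqP <-; exists P, b'.
case=> P [b' [/branch_inv[j [P' br]] cr]].
have IHk k := IH k _ _ (pia_tree_child pia).
have [smp|[sk other]] := pia_node_cases pia br cr.
  by move: h h'; rewrite !smp => h h' k; apply: IHk.
pose x k := eval2 (b (+) node_otype k) u v (args k).
have xE u1 v1 : (forall q, Omega q p -> v q = v1 q) ->
    (fun k => eval2 (b (+) node_otype k) u1 v1 (args k)) =
    setc x j (eval2 (b (+) node_otype j) u1 v1 (args j)).
  move=> vv1; apply/funext => k; rewrite /setc; case: eqP => [->//|/eqP kj].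
  apply: eval2_eq => P1 i1 b1 /(other _ kj)[/negbTE-> om].
  by rewrite vv1.
move: h h'; rewrite !xE// => h h'.
set a := eval2 _ _ v _ in h; set a' := eval2 _ _ _ _ in h'.
(* The two hypotheses differ in coordinate [j] only, so they combine into one about the signed meet
   of [a] and [a'], to which the induction hypothesis applies. *)
apply: sle_trans (_ : sle b _ (node_eval O (setc x j
    (sjoin (~~ (b (+) node_otype j)) a a')))) _.
  rewrite -sleN; apply: bounds_le (Opr sk x (X := [set a; a']) (j := j) _ _) _.
  - by exists a; left.
  - by rewrite addNb; exact: bounds_join.
  - by move=> _ [_ [->|->] <-]; rewrite sleN.
apply: Cmono => k; rewrite /setc; case: eqP => [->|_]; last exact: sle_refl.
by apply: IHk; [exact: sle_meetl|exact: sle_meetr].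
Qed.

(** * Systems of constraints and their least solutions *)

Variables (H : Type) (sg : H -> bool) (al : H -> term S L N) (w : H -> C).
Hypothesis al_pia : forall h, pia_tree Omega eps (sg h) (al h).

Definition solution v := forall h, sle (sg h) (w h) (eval O v (al h)).

Definition vtop : 'I_N -> C := fun i => sbot C (~~ eps i).

Definition below p v : 'I_N -> C := fun q => if Omega q p then v q else sbot C (eps q).

(* The extreme values given to the critical leaves other than p, and to the   *)
(* non-critical leaves outside the Omega-predecessors of p, neutralize them.  *)
Definition admissible p v c :=
  forall h, sle (sg h) (w h) (eval2 (sg h) (setc vtop p c) (below p v) (al h)).

Lemma below_le p v i : sle (eps i) (below p v i) (v i).
Proof. by rewrite /below; case: ifP => _; [exact: sle_refl|exact: sbot_le]. Qed.

Lemma le_vtop_set p u i : sle (eps i) (u i) (setc vtop p (u p) i).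
Proof.
rewrite /setc; case: eqP => [->|_]; first exact: sle_refl.
exact: sle_sbotN.
Qed.

Lemma admissible_mono p v v' c c' :
  (forall q, Omega q p -> sle (eps q) (v' q) (v q)) -> sle (eps p) c c' ->
  admissible p v c -> admissible p v' c'.
Proof.
move=> vv cc h k; apply: sle_trans (h k) _; apply: eval2_Cmono => i.
  by rewrite /setc; case: eqP => [->|_] //; exact: sle_refl.
by rewrite /below; case: ifP => [/vv//|_]; exact: sle_refl.
Qed.

Lemma solution_admissible p v : solution v -> admissible p v (v p).
Proof.
move=> h k; apply: sle_trans (h k) _; rewrite -(eval2_diag eps O (sg k)).
by apply: eval2_Cmono => i; [exact: le_vtop_set|exact: below_le].
Qed.

Lemma solution_vtop v v' : (forall i, sle (eps i) (v' i) (v i)) -> solution v ->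
  forall h, sle (sg h) (w h) (eval2 (sg h) vtop v' (al h)).
Proof.
move=> vv h k; apply: sle_trans (h k) _; rewrite -(eval2_diag eps O (sg k)).
by apply: eval2_Cmono => // i; exact: sle_sbotN.
Qed.

(** In the twisted order [v] is the meet of [vtop] and of the valuations changing [vtop] at one [p]
    to some [c] in [X p]. With [v] at the non-critical leaves each of these satisfies the
    constraints by [eval2_indep], hence so does their meet by [eval2_bounds]. *)
Lemma admissible_solution v (X : 'I_N -> set C) :
  (forall h, sle (sg h) (w h) (eval2 (sg h) vtop v (al h))) ->
  (forall p, bounds (~~ eps p) (X p) (v p)) ->
  (forall p c, X p c -> admissible p v c) -> solution v.
Proof.
move=> vt Xv adm k; rewrite -(eval2_diag eps O (sg k)).
apply: (@eval2_bounds _ _ [set u | u = vtop \/ exists p c, X p c /\ u = setc vtop p c]) => //.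
- by exists vtop; left.
- move=> i; apply: boundsI => [_ [u [->|[p [c [Xc ->]]]] <-]|y hy].
  + exact: sbot_le.
  + rewrite /setc; case: eqP => [->|_]; last exact: sbot_le.
    exact: bounds_ub (Xv p) Xc.
  + apply: bounds_le (Xv i) _ => c Xc; apply: hy; exists (setc vtop i c).
      by right; exists i, c.
    by rewrite setcE.
- move=> u [->//|[p [c [Xc ->]]]]; apply: (@eval2_indep _ _ _ _ _ (below p v)) => //.
    by move=> q qp; rewrite /below qp.
  exact: adm.
Qed.

(** [M] restricts the values tested: elements given by worlds make the result definable, elements of
    the original algebra make it closed. *)
Definition candidate (M : 'I_N -> set C) (p : 'I_N) (v : 'I_N -> C) : C :=
  sSup (~~ eps p) [set c | M p c /\ admissible p v c].

Definition rank p := #|[pred q | Omega q p]|.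

Hypotheses (Oirr : irreflexive Omega) (Otr : transitive Omega).

Lemma rank_lt p q : Omega q p -> (rank q < rank p)%N.
Proof.
move=> qp; apply: proper_card; apply/properP; split.
  by apply/fintype.subsetP => r; rewrite !inE => rq; exact: Otr rq qp.
by exists q; rewrite !inE ?Oirr.
Qed.

Lemma rank_lt_size p : (rank p < N)%N.
Proof.
rewrite -[X in (_ < X)%N]card_ord; apply: proper_card; apply/properP; split.
  exact/fintype.subsetP.
by exists p => //; rewrite inE Oirr.
Qed.

(** All ranks are below [N] and a value depends only on those at smaller rank, so [N] rounds reach a
    fixed point, whether or not the system is solvable. *)
Definition minval (M : 'I_N -> set C) : 'I_N -> C :=
  iter N (fun v p => candidate M p v) vtop.

Lemma candidate_eq M p v v' :
  (forall q, Omega q p -> v q = v' q) -> candidate M p v = candidate M p v'.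
Proof.
move=> vv; rewrite /candidate.
suff -> : admissible p v = admissible p v' by [].
rewrite /admissible; suff -> : below p v = below p v' by [].
by apply/funext => q; rewrite /below; case: ifP => // /vv.
Qed.

Lemma minval_fix M p : minval M p = candidate M p (minval M).
Proof.
pose F v p := candidate M p v.
suff stable n : (rank p < n)%N -> iter n F vtop p = F (iter n F vtop) p.
  exact: stable (rank_lt_size p).
elim: n p => // n IH p pn; rewrite [LHS]/=; apply: candidate_eq => q qp.
by rewrite [RHS]/=; apply: IH; exact: leq_trans (rank_lt qp) _.
Qed.

Lemma minval_bounds M p : bounds (~~ eps p)
  [set c | M p c /\ admissible p (minval M) c] (minval M p).
Proof. by rewrite [X in bounds _ _ X]minval_fix; exact: sSup_bounds. Qed.

(** The first hypothesis says that [M] is rich enough to approximate every admissible value. By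
    induction on the rank [minval] lies below [v] at the smaller variables, which keeps [v p]
    admissible. *)
Lemma minval_le M v :
  (forall p c, admissible p (minval M) c -> sle (eps p) (minval M p) c) ->
  solution v -> forall p, sle (eps p) (minval M p) (v p).
Proof.
move=> Mgen sv p; have [n] := ubnP (rank p); elim: n p => // n IH p pn.
apply: Mgen; apply: admissible_mono (sle_refl _ _) (solution_admissible p sv).
by move=> q qp; apply: IH; exact: leq_trans (rank_lt qp) _.
Qed.

Lemma minval_solution M v :
  (forall p c, admissible p (minval M) c -> sle (eps p) (minval M p) c) ->
  solution v -> solution (minval M).
Proof.
move=> Mgen sv; apply: (@admissible_solution _
  (fun p => [set c | M p c /\ admissible p (minval M) c])).
- exact: solution_vtop (minval_le Mgen sv) sv.
- exact: minval_bounds.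
- by move=> p c [].
Qed.

End MinimalValuation.

(** * Reduction of an inequality to its holes *)

Section HoleReduction.
Context (S : signature) (L : lang) (N : nat) (s t : term S L N).

Definition ineq_holes : finType := (holes false s + holes true t)%type.

Definition ineq_hole (h : ineq_holes) : bool * term S L N :=
  match h with inl h => hole h | inr h => hole h end.

Lemma ineq_hole_pia Omega eps h :
  inductive_tree Omega eps false s -> inductive_tree Omega eps true t ->
  pia_tree Omega eps (ineq_hole h).1 (ineq_hole h).2.
Proof. by move=> si ti; case: h => h; exact: hole_pia_tree. Qed.

Context d (C : tbDistrLatticeType d) (O : operations S L C).
Hypothesis Opr : node_preserving O (@inhabited_sets C).

Definition hole_solution (w : ineq_holes -> C) (v : 'I_N -> C) : Prop :=
  solution O (fun h => (ineq_hole h).1) (fun h => (ineq_hole h).2) w v.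

Definition sk_le (w : ineq_holes -> C) : Prop :=
  sk_eval O (fun h => w (inl h)) <= sk_eval O (fun h => w (inr h)).

Lemma hole_solution_le w v :
  hole_solution w v -> eval O v s <= eval O v t -> sk_le w.
Proof.
move=> sol st.
apply: le_trans (_ : _ <= eval O v s) _.
  rewrite -(sk_eval_hole O false) -[_ <= _]/(sle false _ _).
  by apply: sk_eval_mono (@pairs_inhabited C) Opr _ => h; exact: (sol (inl h)).
apply: le_trans st _.
rewrite -(sk_eval_hole O true) -[_ <= _]/(sle true _ _).
by apply: sk_eval_mono (@pairs_inhabited C) Opr _ => h; exact: (sol (inr h)).
Qed.

(** For the converse, the values of the holes under [v] are approximated by generators, once for
    each side; [v] itself solves every system that arises in this way. *)
Lemma valid_holes (G : bool -> set C) :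
  (forall b a, exists2 X, X !=set0 /\ X `<=` G b & bounds b X a) ->
  valid O s t <->
  forall w, (forall h, G (ineq_hole h).1 (w h)) ->
    (exists v, hole_solution w v) -> sk_le w.
Proof.
move=> Ggen; split=> [val w _ [v sol]|h v].
  exact: hole_solution_le sol (val v).
rewrite -(sk_eval_hole O false) -[_ <= _]/(sle false _ _).
apply: (sk_eval_approx Opr Ggen) => w Gw ws.
rewrite -(sk_eval_hole O true) -[sle _ _ _]/(sle true _ _).
apply: (sk_eval_approx Opr Ggen) => w' Gw' wt /=.
pose w0 (h : ineq_holes) := match h with inl h => w h | inr h => w' h end.
have := h w0; apply; first by case.
by exists v; case.
Qed.

End HoleReduction.

(** * Perfect algebras *)

Section PerfectAlgebra.
Context (S : signature) (L : lang) d (A : tbDistrLatticeType d).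
Context (O : operations S L A) (perf : is_perfect O).

Let cA : complete A. Proof. by case: perf. Qed.

(** Complete distributivity is applied to the two-member family formed by [X] and the singleton of
    [a]. *)
Lemma perfect_frame_meet (a c z : A) (X : set A) :
  bounds false X c -> (forall y, X y -> Order.meet y a <= z) -> Order.meet c a <= z.
Proof.
move=> Xc h; have [_ _ cd _ _] := perf.
have := cd bool (fun i => if i then X else [set a]).
set I := Inf _; set J := Sup _ => IJ.
apply: le_trans (_ : I <= z); last first.
  rewrite IJ; apply: (sSup_le (b := false) cA) => _ [phi hphi <-].
  apply: le_trans (h _ (hphi true)); rewrite lexI.
  rewrite -[X in _ && (_ <= X)](hphi false : phi false = a).
  have phiI i : Inf (range phi) <= phi i by apply: (@sle_sSup _ _ true _ _ cA); exists i.
  by rewrite !phiI.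
apply: (sSup_le (b := true) cA) => _ [[] _ <-] /=.
  by rewrite (bounds_sSup cA Xc : Sup X = c) leIl.
by rewrite (bounds_sSup cA (bounds1 false a) : Sup [set a] = a) leIr.
Qed.

(** By the frame law [j] is the join of its meets with the members of [X], so it equals one of
    them. *)
Lemma Jinf_prime (j c : A) X :
  Jinf j -> bounds false X c -> j <= c -> exists2 x, X x & j <= x.
Proof.
move=> Jj Xc jc.
have [x Xx xj] : [set Order.meet x j | x in X] j.
  apply: Jj; apply: (@boundsI _ _ false) => [_ [x _ <-]|y hy]; first exact: leIr.
  rewrite /= -(meet_idPr jc); apply: perfect_frame_meet Xc _ => x Xx.
  by apply: hy; exists x.
by exists x => //; rewrite -xj leIl.
Qed.

Lemma le_JinfP (x y : A) :
  (forall j : {x : A | Jinf x}, sval j <= x -> sval j <= y) -> x <= y.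
Proof.
move=> h; have [_ _ _ [gen _] _] := perf; have [X XJ Xx] := gen x.
apply: (@bounds_le _ _ false _ _ _ Xx) => j Xj.
exact: (h (exist _ j (XJ _ Xj))) (bounds_ub (b := false) Xx Xj).
Qed.

Lemma le_kappa (j : {x : A | Jinf x}) a : (a <= kappa (sval j)) = ~~ (sval j <= a).
Proof.
apply/idP/idP => [ak|ja]; last exact: (@sle_sSup _ _ false [set a | ~~ (sval j <= a)] a cA ja).
apply/negP => /le_trans/(_ ak) jk.
have [x /= + jx] := Jinf_prime (svalP j) (sSup_bounds false _ cA) jk.
by rewrite jx.
Qed.

(** The order dual of the frame law is tested on completely join-irreducible [j]: being prime, [j]
    lies below [a] or below every member of [X]. *)
Lemma perfect_preserving : node_preserving O (@inhabited_sets A).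
Proof.
have [[_ impP] _ _ _ opP] := perf.
apply: node_preservingP => // -[] a X c z [x0 Xx0] Xc h /=; last first.
  exact: perfect_frame_meet Xc h.
apply: le_JinfP => j jz.
have prime (x y : A) : sval j <= Order.join x y -> (sval j <= x) || (sval j <= y).
  move=> /(Jinf_prime (svalP j) (bounds_join false x y))[_ [->|->] ->//].
  by rewrite orbT.
have [ja|ja] := boolP (sval j <= a); first by rewrite (le_trans ja) ?leUr.
apply: le_trans (leUl _ _); apply: (@bounds_le _ _ true _ _ _ Xc) => y Xy /=.
have := prime y a (le_trans jz (h _ Xy)); by rewrite (negbTE ja) orbF.
Qed.

Definition frame_elt (b : bool) (a : A) : A := if b then kappa a else a.

(** [sbot] keeps the approximating sets nonempty; it stands for the coordinates outside [P] in a
    relation of the dual frame. *)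
Definition frame_gen (b : bool) : set A :=
  [set a | a = sbot A b \/ exists j : {x : A | Jinf x}, a = frame_elt b (sval j)].

Lemma frame_elt_bounds b x :
  bounds b [set a | (exists j : {x : A | Jinf x}, a = frame_elt b (sval j)) /\ sle b a x] x.
Proof.
apply: boundsI => [a []//|]; case: b => /= y hy; apply: le_JinfP => j jx.
  apply: contraT => njx; rewrite -le_kappa in njx.
  have := hy (kappa (sval j)) (conj (ex_intro _ j erefl) njx).
  by rewrite le_kappa jx.
exact: (hy (sval j) (conj (ex_intro _ j erefl) jx)).
Qed.

Lemma frame_gen_bounds b x :
  bounds b [set a | frame_gen b a /\ sle b a x] x.
Proof.
apply: boundsI => [a []//|y hy]; apply: bounds_le (frame_elt_bounds b x) _.
by move=> a [ha ax]; apply: hy; split=> //; right.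
Qed.

Definition op_test (o : opsym) (x : A) (a : A) : Prop :=
  if is_meet_op o then a <= kappa x else x <= a.

(** The relations of the dual frame determine the operation: its arguments are approximated by
    generators, and [P] collects the coordinates whose generator comes from a world. *)
Lemma op_testP (o : opsym) (j : {x : A | Jinf x}) (u : 'I_(arity S o) -> A) :
  op_test o (sval j) (opn O o (finfun u)) <->
  exists (P : {set 'I_(arity S o)}) (y : {i | i \in P} -> {x : A | Jinf x}),
    (forall p, sle (is_meet_op o (+) otype S o (val p))
       (frame_elt (is_meet_op o (+) otype S o (val p)) (sval (y p))) (u (val p))) /\
    dual_rel O (sval j) (fun p => sval (y p)).
Proof.
pose c i := is_meet_op o (+) otype S o i.
have argE (P : {set 'I_(arity S o)}) (y : {i | i \in P} -> A) i :
    frame_args y i = if insub i is Some p then frame_elt (c i) (y p) else sbot A (c i).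
  by rewrite ffunE /c addbC; case: insub => [p|]; case: (_ (+) _).
split; last first.
  case=> P [y [yu rel]].
  have arg_le : sle (is_meet_op o) (opn O o (frame_args (fun p => sval (y p))))
      (opn O o (finfun u)).
    have := @node_mono S L _ _ O _ (@pairs_inhabited A) perfect_preserving
      (@NOp L o) (is_meet_op o) (frame_args (fun p => sval (y p))) u.
    rewrite /= (_ : finfun (frame_args _) = frame_args (fun p => sval (y p))).
      apply=> i; rewrite argE; case: insubP => [p _ <-|_]; first exact: yu.
      exact: sbot_le.
    by apply/ffunP => i; rewrite ffunE.
  move: rel arg_le; rewrite /dual_rel /op_test; case: is_meet_op => /= h1 h2.
    exact: le_trans h2 h1.
  exact: le_trans h1 h2.
move=> test.
have [y [Gy [yu ytest]]] : exists y : 'I_(arity S o) -> A,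
   (forall i, frame_gen (c i) (y i)) /\ (forall i, sle (c i) (y i) (u i)) /\
   op_test o (sval j) (opn O o (finfun y)).
  pose X i := [set a | frame_gen (c i) a /\ sle (c i) a (u i)].
  have approx z := @node_approx S L _ A O (@NOp L o) (is_meet_op o) u X z
    perfect_preserving.
  have sk : skeleton (is_meet_op o) (@NOp L o) by case: (o).
  have X0 i : X i !=set0.
    by exists (sbot A (c i)); split; [left|exact: sbot_le].
  have Xu i : bounds (c i) (X i) (u i) := frame_gen_bounds _ _.
  have {approx} approx z := approx z sk X0 Xu.
  apply: contrapT => no.
  have {}no y : (forall i, X i (y i)) -> ~ op_test o (sval j) (opn O o (finfun y)).
    move=> Xy yt; apply: no; exists y.
    by split; [move=> i; case: (Xy i)|split=> // i; case: (Xy i)].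
  (* For a meet operation, failure of the test at every [y] puts [j] below the value at [u], against
     [le_kappa]; for a join operation primality of [j] selects a [y]. *)
  move: test no approx {sk}; rewrite /op_test; case: is_meet_op => /= test no approx.
    have ux : sval j <= opn O o (finfun u).
      apply: (approx (sval j)) => y Xy.
      have /negP := no y Xy; apply: contraNT.
      by rewrite -le_kappa.
    by have := le_trans ux test; rewrite le_kappa lexx.
  pose Z := [set opn O o (finfun y) | y in [set y | forall i, X i (y i)]].
  have uZ : opn O o (finfun u) <= Sup Z.
    apply: approx => y Xy; apply: (@sle_sSup _ _ false _ _ cA).
    by exists y.
  have [_ [y Xy <-]] := Jinf_prime (svalP j) (sSup_bounds false Z cA) (le_trans test uZ).
  exact: no.
pose P : {set 'I_(arity S o)} :=
  finset (fun i => `[< exists k : {x : A | Jinf x}, y i = frame_elt (c i) (sval k) >]).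
have yP (p : {i | i \in P}) : exists k : {x : A | Jinf x},
    y (val p) = frame_elt (c (val p)) (sval k).
  by have := valP p; rewrite inE => /asboolP.
have [k yk] := choice yP.
exists P, k; split=> [p|]; first by rewrite -yk; exact: yu.
suff argE' : frame_args (fun p => sval (k p)) = finfun y by rewrite /dual_rel argE'.
apply/ffunP => i; rewrite argE ffunE; case: insubP => [p _ <-|nP]; first by rewrite yk.
case: (Gy i) => [->//|ex]; case/negP: nP; rewrite inE; exact/asboolP.
Qed.

End PerfectAlgebra.

(** * First-order definability over dual frames *)

Record perfect_algebra (S : signature) (L : lang) := PerfectAlg {
  pa_disp : Order.disp_t;
  pa_sort : tbDistrLatticeType pa_disp;
  pa_ops : operations S L pa_sort;
  pa_perfect : is_perfect pa_ops }.

Definition worlds S L (B : perfect_algebra S L) : Type := {x : pa_sort B | Jinf x}.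

Definition scons (X V W : Type) (v : V -> X) (w : W -> X) (z : V + W) : X :=
  match z with inl a => v a | inr i => w i end.

(* Satisfaction is only typed for variables in Set, and ordinals live in a     *)
(* larger universe.                                                           *)
Definition small (n : nat) : Set := {k : nat | (k < n)%N}.

Definition to_ord n (k : small n) : 'I_n := Ordinal (proj2_sig k).

Definition of_ord n (i : 'I_n) : small n := exist _ (nat_of_ord i) (ltn_ord i).

Lemma of_ordK n (i : 'I_n) : to_ord (of_ord i) = i.
Proof. exact: val_inj. Qed.

Section Formulas.
Context (S : signature).

Fixpoint fmap (V W : Set) (r : V -> W) (phi : form S V) {struct phi} : form S W :=
  match phi with
  | FBot => FBot S W
  | FEq x y => FEq S (r x) (r y)
  | FLe x y => FLe S (r x) (r y)
  | FRel o P x y => FRel (r x) (r \o y)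
  | FAnd p q => FAnd (fmap r p) (fmap r q)
  | FOr p q => FOr (fmap r p) (fmap r q)
  | FImp p q => FImp (fmap r p) (fmap r q)
  | FAll p => FAll (fmap (omap r) p)
  | FEx p => FEx (fmap (omap r) p)
  end.

Lemma sat_fmap (F : frame S) : forall (V W : Set) (r : V -> W) (phi : form S V)
  (v : W -> F), sat (fmap r phi) v <-> sat phi (v \o r).
Proof.
have E (U U' : Set) (q : U -> U') (u : U' -> F) x :
    (fun z => oapp u x z) \o omap q = (fun z => oapp (u \o q) x z).
  by apply/funext => -[].
fix IH 4 => V W r phi v.
case: phi => [|x y|x y|o P x y|p q|p q|p q|p|p] //=.
- by rewrite !IH.
- by rewrite !IH.
- by rewrite !IH.
- by split=> h x; move: (h x); rewrite IH E.
- by split=> -[x h]; exists x; move: h; rewrite IH E.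
Qed.

End Formulas.

Section Definability.
Context (S : signature) (L : lang).
Local Notation palg := (perfect_algebra S L).

Definition predicate (V : Set) := forall B : palg, (V -> worlds B) -> Prop.

(** Definability is semantic and uniform in the algebra: closure properties of this notion replace
    an explicit construction of the sentence. *)
Definition definable (V : Set) (Phi : predicate V) : Prop :=
  exists phi : form S V, forall (B : palg) (v : V -> worlds B),
    @sat S (dual_frame (pa_ops B)) V phi v <-> Phi B v.

Section Connectives.
Context (V : Set).
Implicit Types Phi Psi : predicate V.

Lemma definable_ext Phi Psi :
  (forall B v, Phi B v <-> Psi B v) -> definable Phi -> definable Psi.
Proof. by move=> h [phi hphi]; exists phi => B v; rewrite hphi. Qed.

Lemma definable_false : definable (fun B (v : V -> worlds B) => False).
Proof. by exists (FBot S V). Qed.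

Lemma definable_and Phi Psi : definable Phi -> definable Psi ->
  definable (fun B v => Phi B v /\ Psi B v).
Proof.
by move=> [p hp] [q hq]; exists (FAnd p q) => B v; rewrite /= hp hq.
Qed.

Lemma definable_or Phi Psi : definable Phi -> definable Psi ->
  definable (fun B v => Phi B v \/ Psi B v).
Proof.
by move=> [p hp] [q hq]; exists (FOr p q) => B v; rewrite /= hp hq.
Qed.

Lemma definable_imp Phi Psi : definable Phi -> definable Psi ->
  definable (fun B v => Phi B v -> Psi B v).
Proof.
by move=> [p hp] [q hq]; exists (FImp p q) => B v; rewrite /= hp hq.
Qed.

Lemma definable_not Phi : definable Phi -> definable (fun B v => ~ Phi B v).
Proof. by move=> h; exact: definable_imp h definable_false. Qed.

Lemma definable_true : definable (fun B (v : V -> worlds B) => True).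
Proof. by exists (FImp (FBot S V) (FBot S V)) => B v; split=> //= _. Qed.

Lemma definable_le (x y : V) : definable (fun B (v : V -> worlds B) => sval (v x) <= sval (v y)).
Proof. by exists (FLe S x y). Qed.

Lemma definable_forall (Psi : predicate (option V)) : definable Psi ->
  definable (fun B v => forall w : worlds B, Psi B (fun z => oapp v w z)).
Proof.
move=> [p hp]; exists (FAll p) => B v /=.
by split=> h w; have := h w; rewrite (hp B).
Qed.

Lemma definable_forall_fin (I : finType) (Psi : I -> predicate V) :
  (forall i, definable (Psi i)) -> definable (fun B v => forall i, Psi i B v).
Proof.
move=> h; have [phi hphi] := choice h.
suff H (r : seq I) : definable (fun B v => forall i, i \in r -> Psi i B v).
  apply: definable_ext (H (enum I)) => B v; split=> hi i; last by move=> _.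
  by apply: hi; rewrite mem_enum.
elim: r => [|i r IH]; first by apply: definable_ext definable_true.
apply: definable_ext (definable_and (h i) IH) => B v; split.
  by move=> [hi hr] k; rewrite inE => /predU1P[->//|]; exact: hr.
by move=> hr; split=> [|k kr]; apply: hr; rewrite inE ?eqxx ?kr ?orbT.
Qed.

Lemma definable_exists_fin (I : finType) (Psi : I -> predicate V) :
  (forall i, definable (Psi i)) -> definable (fun B v => exists i, Psi i B v).
Proof.
move=> h; apply: definable_ext (definable_not (definable_forall_fin
  (fun i => definable_not (h i)))) => B v; split.
  by move=> /existsNP[i /contrapT]; exists i.
by move=> [i hi] /(_ i).
Qed.

End Connectives.

Lemma definable_rename (V W : Set) (r : V -> W) (Phi : predicate V) :
  definable Phi -> definable (fun B (v : W -> worlds B) => Phi B (v \o r)).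
Proof.
by move=> [p hp]; exists (fmap r p) => B v; rewrite sat_fmap hp.
Qed.

Lemma definable_forall_ord n (V : Set) (Psi : predicate (V + small n)) :
  definable Psi ->
  definable (fun B v => forall w : 'I_n -> worlds B, Psi B (scons v (w \o @to_ord n))).
Proof.
elim: n V Psi => [|n IH] V Psi hPsi.
  have e0 : small 0 -> V by case.
  pose r (z : V + small 0) : V := match z with inl a => a | inr i => e0 i end.
  apply: definable_ext (definable_rename r hPsi) => B v.
  have E (w : 'I_0 -> worlds B) : v \o r = scons v (w \o @to_ord 0).
    by apply/funext => -[//|[]].
  split=> [h w|h]; first by rewrite -E.
  have w0 : 'I_0 -> worlds B by case.
  by rewrite (E w0); exact: h.
(* Index 0 becomes the variable of the outermost quantifier, the other indices are shifted down. *)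
pose r (z : V + small n.+1) : option V + small n :=
  match z with
  | inl a => inl (Some a)
  | inr i => if unlift ord0 (to_ord i) is Some k then inr (of_ord k) else inl None
  end.
apply: definable_ext (definable_forall (IH _ _ (definable_rename r hPsi))) => B v.
have E x (w : 'I_n -> worlds B) : scons (fun z => oapp v x z) (w \o @to_ord n) \o r =
    scons v ((fun i => oapp w x (unlift ord0 i)) \o @to_ord n.+1).
  apply/funext => -[//|i] /=; case: unliftP => //= k _.
  by rewrite of_ordK.
split=> h w.
  have := h (w ord0) (fun k => w (lift ord0 k)); rewrite E.
  congr (Psi B (scons v (_ \o _))); apply/funext => i.
  by case: unliftP => [k ->|->].
by move=> w'; rewrite E; exact: h.
Qed.

Lemma definable_forall_fun (V : Set) (I : finType) (Psi : predicate (V + small #|I|))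
    (Phi : forall B : palg, (V -> worlds B) -> (I -> worlds B) -> Prop) :
  (forall B v w, Psi B (scons v (w \o enum_val \o @to_ord _)) <-> Phi B v w) ->
  definable Psi -> definable (fun B v => forall w, Phi B v w).
Proof.
move=> PsiE hPsi; apply: definable_ext (definable_forall_ord hPsi) => B v.
split=> h w; first exact/PsiE/(h (w \o enum_val)).
have /PsiE := h (w \o enum_rank); congr (Psi B (scons v _)).
by apply/funext => i /=; rewrite enum_valK.
Qed.

(** * Elements of the algebra as definable sets of worlds *)

Definition element (V : Set) := forall B : palg, (V -> worlds B) -> pa_sort B.

(** An element is coded by the set of worlds below it, [None] being the variable for such a world.
    Join-generation by [Jinf] makes the code faithful, so inequalities become first-order. *)
Definition definable_elt (V : Set) (X : element V) : Prop :=
  definable (fun B (v : option V -> worlds B) => sval (v None) <= X B (v \o Some)).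

Lemma definable_at (V W : Set) (X : element V) (r : V -> W) y : definable_elt X ->
  definable (fun B (v : W -> worlds B) => sval (v y) <= X B (v \o r)).
Proof. by move=> /(definable_rename (fun z => oapp r y z)). Qed.

Lemma definable_elt_rename (V W : Set) (r : V -> W) (X : element V) :
  definable_elt X -> definable_elt (fun B v => X B (v \o r)).
Proof. by move=> /(definable_at (Some \o r) None). Qed.

Section Elements.
Context (V : Set).
Implicit Types (X Y : element V).

Lemma definable_elt_ext X Y :
  (forall B v, X B v = Y B v) -> definable_elt X -> definable_elt Y.
Proof. by move=> h; apply: definable_ext => B v; rewrite h. Qed.

Lemma definable_leq X Y : definable_elt X -> definable_elt Y ->
  definable (fun B v => X B v <= Y B v).
Proof.
move=> hX hY; apply: definable_ext (definable_forall (definable_imp hX hY)) => B v.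
split=> [h|h j jX]; last exact: le_trans jX h.
by apply: (le_JinfP (pa_perfect B)) => j; exact: h.
Qed.

Lemma definable_sle b X Y : definable_elt X -> definable_elt Y ->
  definable (fun B v => sle b (X B v) (Y B v)).
Proof. by move=> hX hY; case: b; exact: definable_leq. Qed.

Lemma definable_frame_elt b x :
  definable_elt (fun B (v : V -> worlds B) => frame_elt b (sval (v x))).
Proof.
rewrite /definable_elt; case: b => /=; last exact: definable_le.
apply: definable_ext (definable_not (definable_le (Some x) None)) => B v.
by rewrite (le_kappa (pa_perfect B)); split => [/negP|/negP].
Qed.

End Elements.

Section ElementOperations.
Context (V : Set).
Implicit Types (X Y : element V).

Lemma definable_sbot b : definable_elt (fun B (v : V -> worlds B) => sbot (pa_sort B) b).
Proof.
case: b => /=; first by apply: definable_ext (definable_true _) => B v; rewrite /= lex1.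
apply: definable_ext (definable_false _) => B v; split => // j0.
(* The bottom is the supremum of the empty set, so no world lies below it. *)
have bot0 : bounds false set0 (\bot : pa_sort B).
  by apply: boundsI => // y _; exact: le0x.
by have [x] := Jinf_prime (pa_perfect B) (svalP (v None)) bot0 j0.
Qed.

Lemma definable_meet X Y : definable_elt X -> definable_elt Y ->
  definable_elt (fun B v => Order.meet (X B v) (Y B v)).
Proof.
move=> hX hY; apply: definable_ext (definable_and hX hY) => B v.
by rewrite lexI; split=> /andP.
Qed.

Lemma definable_join X Y : definable_elt X -> definable_elt Y ->
  definable_elt (fun B v => Order.join (X B v) (Y B v)).
Proof.
move=> hX hY; apply: definable_ext (definable_or hX hY) => B v; split.
  by case=> h; [apply: le_trans h _; exact: leUl|apply: le_trans h _; exact: leUr].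
move=> h; have [_ [->|->]] := Jinf_prime (pa_perfect B) (svalP (v None))
  (bounds_join false _ _) h; by [left|right].
Qed.

(** The clause for implication is that of intuitionistic Kripke semantics, over the worlds below the
    current one. *)
Lemma definable_imp_elt (har : is_HAR L) X Y : definable_elt X -> definable_elt Y ->
  definable_elt (fun B v => imp (pa_ops B) har (X B v) (Y B v)).
Proof.
move=> hX hY; apply: definable_ext (definable_forall (definable_imp
  (definable_le None (Some None)) (definable_imp
  (definable_at (Some \o Some) None hX) (definable_at (Some \o Some) None hY)))).
move=> B v; have [[_ impP] _ _ _ _] := pa_perfect B; rewrite -impP; split.
  move=> h; apply: (le_JinfP (pa_perfect B)) => k; rewrite lexI => /andP[kj kX].
  exact: h.
move=> h k kj kX; apply: le_trans h; rewrite lexI.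
exact/andP.
Qed.

(** No quantifier over sets arises: by primality [j] lies below a join of worlds iff it lies below
    one of them, and it lies below a meet of elements [kappa k] iff none of these [k] is below
    [j]. *)
Lemma definable_sSup b (Psi : predicate (option V)) : definable Psi ->
  definable_elt (fun B v => sSup b [set a | (exists k : worlds B,
    a = frame_elt b (sval k) /\ Psi B (fun z => oapp v k z))]).
Proof.
move=> hPsi; pose r (z : option V) : option (option V) := omap Some z.
have rE B (v : option V -> worlds B) k :
    (fun z => oapp v k z) \o r = (fun z => oapp (v \o Some) k z).
  by apply/funext => -[].
have cB (B : palg) : complete (pa_sort B) by case: (pa_perfect B).
case: b.
  apply: definable_ext (definable_forall (definable_imp (definable_rename r hPsi)
    (definable_not (definable_le None (Some None))))) => B v; split.
    move=> h; apply: (sSup_le (b := true) (cB B)) => _ [k [-> hk]] /=.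
    by rewrite (le_kappa (pa_perfect B)); apply/negP; apply: h; rewrite rE.
  move=> h k; rewrite rE => hk; apply/negP; rewrite -(le_kappa (pa_perfect B)).
  apply: le_trans h _; apply: (@sle_sSup _ _ true _ _ (cB B)).
  by exists k.
apply: definable_ext (definable_not (definable_forall (definable_imp
  (definable_rename r hPsi)
  (definable_not (definable_le (Some None) None))))) => B v; split.
  move=> /existsNP[k /not_implyP[]]; rewrite rE => hk /contrapT jk.
  apply: le_trans jk _; apply: (@sle_sSup _ _ false _ _ (cB B)).
  by exists k.
move=> h; have [_ [k [-> hk]] jk] := Jinf_prime (pa_perfect B) (svalP (v None))
  (sSup_bounds false _ (cB B)) h.
by move=> /(_ k); rewrite rE => /(_ hk).
Qed.

Lemma definable_op (o : opsym) (X : 'I_(arity S o) -> element V) :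
  (forall i, definable_elt (X i)) ->
  definable_elt (fun B v => opn (pa_ops B) o (finfun (fun i => X i B v))).
Proof.
move=> hX.
have rel : definable (fun B (v : option V -> worlds B) => op_test o (sval (v None))
    (opn (pa_ops B) o (finfun (fun i => X i B (v \o Some))))).
  pose c i := is_meet_op o (+) otype S o i.
  pose Phi (P : {set 'I_(arity S o)}) B (v : option V -> worlds B)
      (y : {i | i \in P} -> worlds B) :=
    (forall p, sle (c (val p)) (frame_elt (c (val p)) (sval (y p)))
       (X (val p) B (v \o Some))) /\
    dual_rel (pa_ops B) (sval (v None)) (fun p => sval (y p)).
  suff hPhi P : definable (fun B v => exists y, @Phi P B v y).
    apply: definable_ext (definable_exists_fin hPhi) => B v.
    by rewrite (op_testP (pa_perfect B)).
  apply: (@definable_ext _ (fun B v => ~ forall y, ~ @Phi P B v y)).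
    move=> B v; split=> [/existsNP[y /contrapT]|[y hy] /(_ y)//]; by exists y.
  apply: definable_not.
  pose y (p : {i | i \in P}) : option V + small #|{: {i | i \in P}}| :=
    inr (of_ord (enum_rank p)).
  pose Psi : predicate (option V + small #|{: {i | i \in P}}|) := fun B v =>
    ~ ((forall p, sle (c (val p)) (frame_elt (c (val p)) (sval (v (y p))))
         (X (val p) B (v \o (inl \o Some)))) /\
       dual_rel (pa_ops B) (sval (v (inl None))) (fun p => sval (v (y p)))).
  apply: (@definable_forall_fun _ _ Psi (fun B v y => ~ @Phi P B v y)).
    move=> B v w; rewrite /Psi /Phi /= /y.
    have -> : (fun p : {i | i \in P} => sval (w (enum_val (to_ord (of_ord (enum_rank p))))))
      = (fun p => sval (w p)) by apply/funext => p; rewrite of_ordK enum_rankK.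
    split=> h [h1 h2]; apply: h; split=> // p; have := h1 p; by rewrite of_ordK enum_rankK.
  apply/definable_not/definable_and.
    apply: (definable_forall_fin (Psi := fun p B v =>
      sle (c (val p)) (frame_elt (c (val p)) (sval (v (y p))))
         (X (val p) B (v \o (inl \o Some))))) => p.
    apply: definable_sle; first exact: definable_frame_elt.
    exact: definable_elt_rename (hX _).
  by exists (FRel (inl None) y).
(* For a meet operation the test with [kappa j] says that [j] is not below the value. *)
move: rel; rewrite /op_test /definable_elt; case: is_meet_op => // /definable_not.
apply: definable_ext => B v; rewrite (le_kappa (pa_perfect B)).
by split=> [/negP/negPn|h]; [|apply/negP/negPn].
Qed.

Lemma definable_node (nd : node L) (X : 'I_(node_arity S nd) -> element V) :
  (forall i, definable_elt (X i)) ->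
  definable_elt (fun B v => node_eval (pa_ops B) (fun i => X i B v)).
Proof.
case: nd X => [|| | |har|o] X hX /=.
- exact: (definable_sbot true).
- exact: (definable_sbot false).
- exact: definable_meet.
- exact: definable_join.
- exact: definable_imp_elt.
- exact: definable_op.
Qed.

End ElementOperations.

End Definability.

(** * Elementarity *)

Section Elementarity.
Context (S : signature) (L : lang) (N : nat).

Lemma definable_sk_eval (V : Set) b (s : term S L N)
    (w : holes b s -> element S L V) :
  (forall h, definable_elt (w h)) ->
  definable_elt (fun B v => sk_eval (pa_ops B) (fun h => w h B v)).
Proof.
elim: s b w => [i|nd args IH] b /= w hw; first exact: hw.
move: w hw; case: (skeleton b nd) => w hw; last exact: hw.
apply: (definable_node (X := fun j B v => sk_eval (pa_ops B)
  (fun h => w (existT _ j h) B v))) => j.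
by apply: IH => h; exact: hw.
Qed.

Context (Omega : rel 'I_N) (eps : 'I_N -> bool).

Lemma definable_eval2 (V : Set) b (s : term S L N) (u v : 'I_N -> element S L V) :
  (forall i, definable_elt (u i)) -> (forall i, definable_elt (v i)) ->
  definable_elt (fun B x =>
    eval2 eps (pa_ops B) b (fun i => u i B x) (fun i => v i B x) s).
Proof.
move=> hu hv; elim: s b => [i|nd args IH] b; first by rewrite /=; case: (critical eps i b).
apply: (definable_node (X := fun j B x => eval2 eps (pa_ops B)
  (b (+) node_otype j) (fun i => u i B x) (fun i => v i B x) (args j))) => j.
exact: IH.
Qed.

Section Solution.
Context (V : Set) (H : finType) (sg : H -> bool) (al : H -> term S L N).
Context (w : H -> element S L V).
Arguments w : clear implicits.
Hypothesis hw : forall h, definable_elt (w h).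

Lemma definable_solution (v : 'I_N -> element S L V) :
  (forall i, definable_elt (v i)) ->
  definable (fun B x =>
    solution (pa_ops B) sg al (fun h => w h B x) (fun i => v i B x)).
Proof.
move=> hv; apply: (definable_forall_fin (Psi := fun h B x =>
  sle (sg h) (w h B x) (eval (pa_ops B) (fun i => v i B x) (al h)))) => h.
apply: definable_sle => //.
apply: definable_elt_ext (definable_eval2 (sg h) (al h) hv hv) => B x.
exact: eval2_diag.
Qed.

(** In contrast to [frame_gen], [sbot] is left out: [candidate] takes a bound in a complete lattice,
    where the empty set is allowed. *)
Definition frame_candidates (B : perfect_algebra S L) (p : 'I_N) : set (pa_sort B) :=
  [set a | exists k : worlds B, a = frame_elt (~~ eps p) (sval k)].

Lemma definable_candidate p (v : 'I_N -> element S L V) :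
  (forall i, definable_elt (v i)) ->
  definable_elt (fun B x => candidate Omega eps (pa_ops B) sg al
    (fun h => w h B x) (@frame_candidates B) p (fun i => v i B x)).
Proof.
move=> hv.
pose u i : element S L (option V) := fun B x =>
  setc (vtop eps (pa_sort B)) p (frame_elt (~~ eps p) (sval (x None))) i.
pose v' i : element S L (option V) := fun B x =>
  below Omega eps p (fun i => v i B (x \o Some)) i.
pose Psi : predicate S L (option V) := fun B x =>
  forall h, sle (sg h) (w h B (x \o Some))
    (eval2 eps (pa_ops B) (sg h) (fun i => u i B x) (fun i => v' i B x) (al h)).
have hPsi : definable Psi.
  apply: (definable_forall_fin (Psi := fun h B x => sle (sg h) (w h B (x \o Some))
    (eval2 eps (pa_ops B) (sg h) (fun i => u i B x) (fun i => v' i B x) (al h)))).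
  move=> h; apply: definable_sle; first exact: definable_elt_rename.
  apply: definable_eval2 => i; rewrite /u /v' /setc /below.
    by case: (i == p); [exact: definable_frame_elt|exact: definable_sbot].
  by case: (Omega i p); [exact: definable_elt_rename|exact: definable_sbot].
apply: definable_elt_ext (definable_sSup (~~ eps p) hPsi) => B x.
congr sSup; apply/seteqP; split=> a /=.
  by move=> [k [-> hk]]; split; first by exists k.
by move=> [[k ->] hk]; exists k.
Qed.

Lemma definable_minval p :
  definable_elt (fun B x => minval Omega eps (pa_ops B) sg al
    (fun h => w h B x) (@frame_candidates B) p).
Proof.
rewrite /minval.
suff it n q : definable_elt (fun B x => iter n (fun v p => candidate Omega eps
    (pa_ops B) sg al (fun h => w h B x) (@frame_candidates B) p v)
    (vtop eps (pa_sort B)) q) by exact: it.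
elim: n q => [|n IH] q; first exact: definable_sbot.
exact: definable_candidate.
Qed.

End Solution.

Context (s t : term S L N).
Hypotheses (Oirr : irreflexive Omega) (Otr : transitive Omega).
Hypotheses (s_ind : inductive_tree Omega eps false s).
Hypotheses (t_ind : inductive_tree Omega eps true t).

Let H := ineq_holes s t.
Let sg (h : H) := (ineq_hole h).1.
Let al (h : H) := (ineq_hole h).2.

(** [c] tells which holes receive a generator given by a world; the finitely many patterns turn into
    a conjunction. *)
Definition hole_value (c : {ffun H -> bool}) (B : perfect_algebra S L)
    (y : H -> worlds B) (h : H) : pa_sort B :=
  if c h then frame_elt (sg h) (sval (y h)) else sbot (pa_sort B) (sg h).

Definition elementary_instance (c : {ffun H -> bool}) (B : perfect_algebra S L)
    (y : H -> worlds B) : Prop :=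
  solution (pa_ops B) sg al (hole_value c y)
    (minval Omega eps (pa_ops B) sg al (hole_value c y) (@frame_candidates B)) ->
  sk_le (pa_ops B) (hole_value c y).

Lemma valid_elementary B : valid (pa_ops B) s t <->
  forall c (y : H -> worlds B), elementary_instance c y.
Proof.
have perf := pa_perfect B; have Opr := perfect_preserving perf.
have cB : complete (pa_sort B) by case: perf.
have gens b (a : pa_sort B) : exists2 X, X !=set0 /\ X `<=` frame_gen b & bounds b X a.
  exists [set x | frame_gen b x /\ sle b x a]; last exact: (frame_gen_bounds perf).
  split; last by move=> x [].
  by exists (sbot _ b); split; [left|exact: sbot_le].
rewrite (valid_holes s t Opr gens); split=> [h c y sol|h w Gw [v sol]].
  apply: h; last by exists (minval Omega eps (pa_ops B) sg al (hole_value c y)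
    (@frame_candidates B)).
  by move=> k; rewrite /hole_value; case: (c k); [right; exists (y k)|left].
(* Besides reducing the inequality to worlds, [j] serves as the default value of [y]; if there are
   no worlds, the inequality is trivial. *)
apply: (le_JinfP perf) => j jw.
pose elt_of k := exists x : worlds B, w k = frame_elt (sg k) (sval x).
pose c : {ffun H -> bool} := [ffun k => `[< elt_of k >]].
pose y k : worlds B := if pselect (elt_of k) is left e then sval (cid e) else j.
have wE : hole_value c y = w.
  apply/funext => k; rewrite /hole_value ffunE /y.
  case: pselect => e; first by rewrite asboolT// -(svalP (cid e)).
  by rewrite asboolF//; case: (Gw k) => [->|[x ex]]//; case: e; exists x.
have := h c y; rewrite /elementary_instance wE => hcy.
apply: le_trans jw _; apply: hcy.
apply: minval_solution sol => //; first by move=> k; exact: ineq_hole_pia.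
(* In the twisted order an admissible value is the meet of the frame elements above it, and these
   are again admissible, hence candidates. *)
move=> p a adm; rewrite -sleN.
apply: bounds_le (frame_elt_bounds perf (~~ eps p) a) _ => x [[k xk] xa].
apply: (bounds_ub (minval_bounds eps (pa_ops B) cB _ _ _ Oirr Otr _ p)) => /=.
split; first by exists k.
apply: admissible_mono adm => [//|q _|]; [exact: sle_refl|by rewrite -sleN].
Qed.

Lemma elementary : exists chi : sentence S,
  forall d (A : tbDistrLatticeType d) (O : operations S L A),
    is_perfect O -> (valid O s t <-> models (dual_frame O) chi).
Proof.
pose Phi : predicate S L void := fun B _ =>
  forall c (y : H -> worlds B), elementary_instance c y.
suff [chi hchi] : definable Phi.
  exists chi => d A O perf; pose B := PerfectAlg perf.
  exact: iff_trans (valid_elementary B) (iff_sym (hchi B _)).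
apply: (definable_forall_fin (Psi := fun c B (v : void -> worlds B) =>
  forall y : H -> worlds B, elementary_instance c y)) => c.
pose V : Set := (void + small #|H|)%type.
pose w h : element S L V := fun B v => if c h
  then frame_elt (sg h) (sval (v (inr (of_ord (enum_rank h))))) else sbot _ (sg h).
have hw h : definable_elt (w h).
  by rewrite /w; case: (c h); [exact: definable_frame_elt|exact: definable_sbot].
pose Psi : predicate S L V := fun B v =>
  solution (pa_ops B) sg al (fun h => w h B v)
    (minval Omega eps (pa_ops B) sg al (fun h => w h B v) (@frame_candidates B)) ->
  sk_le (pa_ops B) (fun h => w h B v).
apply: (@definable_forall_fun S L void H Psi (fun B v y => elementary_instance c y)).
  move=> B v y; rewrite /Psi /elementary_instance.
  suff -> : (fun h => w h B (scons v (y \o enum_val \o @to_ord _))) = hole_value c y by [].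
  apply/funext => h; rewrite /w /hole_value; case: (c h) => //=.
  by rewrite of_ordK enum_rankK.
apply: definable_imp.
  apply: (definable_solution _ _ hw (v := fun p B v => minval Omega eps (pa_ops B)
    sg al (fun h => w h B v) (@frame_candidates B) p)) => p.
  exact: definable_minval.
apply: definable_leq.
  exact: (definable_sk_eval (w := fun h => w (inl h))).
exact: (definable_sk_eval (w := fun h => w (inr h))).
Qed.

End Elementarity.

(** * Extensions of monotone maps to the canonical extension *)

Section CanonicalExtension.
Context d (A : tbDistrLatticeType d) d' (C : tbDistrLatticeType d').
Context (e : A -> C) (ce : canonical_extension e).
Implicit Types (b : bool).

Let cC : complete C. Proof. by case: ce. Qed.

Lemma ce_sjoin b a a' : e (sjoin b a a') = sjoin b (e a) (e a').
Proof. by case: ce => -[_ [em ej _ _]] _ _ _; case: b; [exact: em|exact: ej]. Qed.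

Lemma ce_sbot b : e (sbot A b) = sbot C b.
Proof. by case: ce => -[_ [_ _ e0 e1]] _ _ _; case: b. Qed.

Lemma ce_sle b a a' : sle b (e a) (e a') = sle b a a'.
Proof.
have le (x y : A) : (e x <= e y) = (x <= y).
  case: ce => -[einj [em _ _ _]] _ _ _.
  by rewrite [RHS]leEmeet [LHS]leEmeet -em (inj_eq einj).
by case: b; exact: le.
Qed.

(** Closed elements for [b = false], open ones for [b = true]; the elements of [A] are both. *)
Definition closedc b : set C := [set x | exists X, bounds (~~ b) (e @` X) x].

Lemma closedcP b x :
  closedc b x <-> bounds (~~ b) (e @` [set a | sle b x (e a)]) x.
Proof.
split=> [[X Xx]|]; last by exists [set a | sle b x (e a)].
apply: boundsI => [_ [a /= xa <-]|y hy]; first by rewrite sleN.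
apply: (bounds_le Xx) => _ [a Xa <-]; apply: hy; exists a => //=.
by rewrite -sleN; apply: (bounds_ub Xx); exists a.
Qed.

Lemma closedc_e b a : closedc b (e a).
Proof. by exists [set a]; rewrite image_set1; exact: bounds1. Qed.

Lemma closedc_sbot b c : closedc b (sbot C c).
Proof. by rewrite -ce_sbot; exact: closedc_e. Qed.

Lemma closedc_sSup b (X : set A) : closedc b (sSup (~~ b) (e @` X)).
Proof. by exists X; exact: sSup_bounds. Qed.

Lemma closedc_bounds b x : bounds b [set y | closedc b y /\ sle b y x] x.
Proof.
have [_ _ [jg mg] _] := ce.
apply: boundsI => [y []//|z hz].
case: b hz => /= hz; last first.
  have [X XK Xx] := jg x.
  apply: (bounds_le (b := false) Xx) => y Xy; apply: hz; split.
    exact: XK.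
  exact: (bounds_ub (b := false) Xx).
have [X XK Xx] := mg x.
apply: (bounds_le (b := true) Xx) => y Xy; apply: hz; split.
  exact: XK.
exact: (bounds_ub (b := true) Xx).
Qed.

Definition sbig b (F : seq A) : A :=
  if b then \meet_(a <- F) a else \join_(a <- F) a.

Lemma sbig_cons b a F : sbig b (a :: F) = sjoin b a (sbig b F).
Proof. by case: b; rewrite /= big_cons. Qed.

Lemma ce_compact b (X Y : set A) x y :
  bounds (~~ b) (e @` X) x -> bounds b (e @` Y) y -> sle b x y ->
  exists F G : seq A, [/\ [set` F] `<=` X, [set` G] `<=` Y &
    sle b (sbig (~~ b) F) (sbig b G)].
Proof.
have [_ _ _ comp] := ce; case: b => /= Xx Yy xy.
  have [|F [G [FY GX FG]]] := comp Y X.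
    by rewrite (bounds_sSup (b := true) cC Yy : Inf _ = y)
      (bounds_sSup (b := false) cC Xx : Sup _ = x).
  by exists G, F.
have [|F [G [FX GY FG]]] := comp X Y; last by exists F, G.
by rewrite (bounds_sSup (b := false) cC Yy : Sup _ = y)
  (bounds_sSup (b := true) cC Xx : Inf _ = x).
Qed.

(** In a directed set the finite subset given by compactness has a single upper bound; nonemptiness
    of [Y] covers the empty subset. *)
Lemma ce_directed b (Y : set A) x y :
  Y !=set0 -> (forall p q, Y p -> Y q -> exists r, [/\ Y r, sle b p r & sle b q r]) ->
  closedc b x -> bounds b (e @` Y) y -> sle b x y ->
  exists2 a, Y a & sle b x (e a).
Proof.
move=> [a0 Ya0] dir [X Xx] Yy xy.
have [F [G [FX GY FG]]] := ce_compact Xx Yy xy.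
have [a [Ya Ga]] : exists a, Y a /\ sle b (sbig b G) a.
  elim: G GY {FG} => [|g G IH] GY.
    by exists a0; split=> //; case: (b); rewrite /sbig big_nil;
      [exact: lex1|exact: le0x].
  have [|a [Ya Ga]] := IH; first by move=> z zG; apply: GY; rewrite /= inE zG orbT.
  have Yg : Y g by apply: GY; rewrite /= inE eqxx.
  have [r [Yr gr ar]] := dir _ _ Yg Ya.
  exists r; split=> //; rewrite sbig_cons sjoin_le gr /=.
  exact: sle_trans Ga ar.
exists a => //; apply: sle_trans (_ : sle b x (e (sbig (~~ b) F))) _; last first.
  by rewrite ce_sle; exact: sle_trans FG Ga.
rewrite -sleN; elim: F FX {FG} => [|f F IH] FX.
  have -> : sbig (~~ b) [::] = sbot A (~~ b).
    by rewrite /sbig /sbot; case: (~~ b); rewrite big_nil.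
  by rewrite ce_sbot; exact: sbot_le.
rewrite sbig_cons ce_sjoin sjoin_le; apply/andP; split.
  apply: (bounds_ub Xx); exists f => //; apply: FX.
  by rewrite /= inE eqxx.
by apply: IH => z zF; apply: FX; rewrite /= inE zF orbT.
Qed.

Lemma ce_interpolate b x y : closedc b x -> closedc (~~ b) y -> sle b x y ->
  exists2 a, sle b x (e a) & sle b (e a) y.
Proof.
move=> Kx /closedcP; rewrite negbK => By xy.
have [|p q|a ya xa] := @ce_directed b [set a | sle (~~ b) y (e a)] x y _ _ Kx By xy.
- exists (sbot A b); rewrite /= ce_sbot sleN; exact: sbot_le.
- rewrite /= !sleN => py qy; exists (sjoin b p q); split.
  + by rewrite sleN ce_sjoin sjoin_le py qy.
  + exact: sle_joinl.
  + exact: sle_joinr.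
- by exists a => //; move: ya; rewrite /= sleN.
Qed.

Section Extension.
Context (n : nat) (eps : 'I_n -> bool) (h : ('I_n -> A) -> A).

Definition sle_fun d0 (T : porderType d0) b (x y : 'I_n -> T) : Prop :=
  forall i, sle (b (+) eps i) (x i) (y i).

Hypothesis h_mono : forall b a a', sle_fun b a a' -> sle b (h a) (h a').

Definition closed_fun b (x : 'I_n -> C) : Prop := forall i, closedc (b (+) eps i) (x i).

Definition ext_closed b (x : 'I_n -> C) : C :=
  sSup (~~ b) [set e (h a) | a in [set a | sle_fun b x (e \o a)]].

(** The sigma extension for [b = false], the pi extension for [b = true]. Plain tuples are used so
    that the lattice operations and implication fit as well. *)
Definition ext b (u : 'I_n -> C) : C :=
  sSup b [set ext_closed b x | x in [set x | closed_fun b x /\ sle_fun b x u]].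

Lemma sle_funN d0 (T : porderType d0) b (x y : 'I_n -> T) :
  sle_fun (~~ b) x y <-> sle_fun b y x.
Proof. by split=> xy i; have := xy i; rewrite addNb sleN. Qed.

Lemma closedc_ext_closed b x : closedc b (ext_closed b x).
Proof.
by rewrite /ext_closed -(image_comp h e); exact: closedc_sSup.
Qed.

Lemma ext_closed_le b x a : sle_fun b x (e \o a) -> sle b (ext_closed b x) (e (h a)).
Proof. by move=> xa; rewrite -sleN; apply: sle_sSup => //; exists a. Qed.

Lemma ext_closed_mono b x y : sle_fun b x y -> sle b (ext_closed b x) (ext_closed b y).
Proof.
move=> xy; rewrite -sleN; apply: sSup_le => // _ [a ya <-]; rewrite sleN.
by apply: ext_closed_le => i; exact: sle_trans (xy i) (ya i).
Qed.

Lemma ext_closed_e b a : ext_closed b (e \o a) = e (h a).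
Proof.
apply: (@sle_anti _ _ b); first by apply: ext_closed_le => i; exact: sle_refl.
rewrite -sleN; apply: sSup_le => // _ [a' aa' <-]; rewrite sleN ce_sle.
by apply: h_mono => i; have := aa' i; rewrite ce_sle.
Qed.

(** The tuples of [A] above [x] are closed under coordinatewise meets, so their values are directed
    downwards and compactness finds a single one. *)
Lemma ext_closed_approx b x z : closed_fun b x -> closedc (~~ b) z ->
  sle b (ext_closed b x) z -> exists2 a, sle_fun b x (e \o a) & sle b (e (h a)) z.
Proof.
move=> Kx Kz; rewrite -sleN => xz.
have [|||a xa za] := @ce_directed (~~ b) (h @` [set a | sle_fun b x (e \o a)]) z
  (ext_closed b x) _ _ Kz _ xz.
- exists (h (fun i => sbot A (~~ (b (+) eps i)))), (fun i => sbot A (~~ (b (+) eps i))) => //.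
  by move=> i /=; rewrite ce_sbot sle_sbotN.
- move=> _ _ [a xa <-] [a' xa' <-].
  pose r i := sjoin (~~ (b (+) eps i)) (a i) (a' i).
  exists (h r); split.
  + by exists r => // i /=; rewrite ce_sjoin sle_meet xa xa'.
  + by rewrite sleN; apply: h_mono => i; exact: sle_meetl.
  + by rewrite sleN; apply: h_mono => i; exact: sle_meetr.
- by rewrite image_comp; exact: sSup_bounds.
by case: xa za => a0 xa0 <-; rewrite sleN => za; exists a0.
Qed.

Lemma ext_le b u z :
  (forall x, closed_fun b x -> sle_fun b x u -> sle b (ext_closed b x) z) ->
  sle b (ext b u) z.
Proof. by move=> hz; apply: sSup_le => // _ [x [Kx xu] <-]; exact: hz. Qed.

Lemma le_ext b u x : closed_fun b x -> sle_fun b x u ->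
  sle b (ext_closed b x) (ext b u).
Proof. by move=> Kx xu; apply: sle_sSup => //; exists x. Qed.

(** Sigma and pi extensions agree at closed and at open tuples, because a tuple of [A] interpolates
    between a closed tuple and an open one above it. *)
Lemma extE b c y : closed_fun c y -> ext b y = ext_closed c y.
Proof.
case: (eqVneq c b) => [->|cb] Ky; apply: (@sle_anti _ _ b).
- by apply: ext_le => x _; exact: ext_closed_mono.
- by apply: le_ext => // i; exact: sle_refl.
- have {}cb : c = ~~ b by case: c b cb {Ky} => -[].
  subst c; apply: ext_le => x Kx xy.
  have xay i : exists a, sle (b (+) eps i) (x i) (e a) /\ sle (b (+) eps i) (e a) (y i).
    have [|a xa ay] := ce_interpolate (Kx i) _ (xy i); last by exists a.
    by rewrite -addNb; exact: Ky.
  have [a ha] := choice xay.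
  apply: sle_trans (_ : sle b _ (e (h a))) _.
    by apply: ext_closed_le => i; case: (ha i).
  rewrite -sleN; apply: ext_closed_le; apply/sle_funN => i; by case: (ha i).
- have {}cb : c = ~~ b by case: c b cb {Ky} => -[].
  subst c; rewrite -{1}[b]negbK; apply: sSup_le => // _ [a ya <-].
  rewrite negbK -(ext_closed_e b); apply: le_ext; last exact/sle_funN.
  by move=> i; exact: closedc_e.
Qed.

Lemma ext_e b a : ext b (e \o a) = e (h a).
Proof. by rewrite (@extE b b) ?ext_closed_e// => i; exact: closedc_e. Qed.

Lemma ext_mono b u u' : sle_fun b u u' -> sle b (ext b u) (ext b u').
Proof.
move=> uu; apply: ext_le => x Kx xu; apply: le_ext => // i.
exact: sle_trans (xu i) (uu i).
Qed.

(* The classical adjunction argument: for open z, a closed x lies below the   *)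
(* open join of those p for which some clopen tuple above x off i, and equal  *)
(* to p at i, is sent below z.                                                *)
Lemma ext_preserves b i u (X : set C) c :
  (forall a p q, h (setc a i (sjoin (b (+) eps i) p q)) =
     sjoin b (h (setc a i p)) (h (setc a i q))) ->
  X !=set0 -> bounds (b (+) eps i) X c ->
  bounds b [set ext b (setc u i y) | y in X] (ext b (setc u i c)).
Proof.
move=> hj [y0 Xy0] Xc; apply: boundsI.
  move=> _ [y Xy <-]; apply: ext_mono => k; rewrite /setc; case: eqP => [->|_].
    exact: bounds_ub Xc Xy.
  exact: sle_refl.
move=> z hz; rewrite -sleN; apply: bounds_le (closedc_bounds (~~ b) z) _.
move=> o [Ko]; rewrite !sleN => zo.
apply: ext_le => x Kx xu.
pose T := [set p | exists a, [/\ a i = p,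
  forall k, k != i -> sle (b (+) eps k) (x k) (e (a k)) & sle b (e (h a)) o]].
pose c' := b (+) eps i.
(* The bound [z] at [y], read at the closed tuple with [y'] in coordinate [i], is turned by
   compactness into a member of [T] above [y']. *)
have XT y y' : X y -> closedc c' y' -> sle c' y' y ->
    exists2 p, T p & sle c' y' (e p).
  move=> Xy Ky' y'y.
  have Kxy : closed_fun b (setc x i y').
    by move=> k; rewrite /setc; case: eqP => [->|].
  have [|a xa ao] := ext_closed_approx Kxy Ko.
    apply: (sle_trans (y := ext b (setc u i y))).
      apply: le_ext Kxy _ => k; have := xu k.
      by rewrite /setc; case: eqP => [->|].
    by apply: sle_trans zo; apply: hz; exists y.
  exists (a i); last by have := xa i; rewrite setcE.
  by exists a; split=> // k ki; have := xa k; rewrite setcNE.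
(* By [XT] the join of [T] lies above every member of [X], hence above [c] and [x i]; preservation
   of joins by [h] makes [T] directed, so one [p] is already above [x i]. *)
have [|||p [a [ap xa ao]] xp] := @ce_directed c' T (x i) (sSup c' (e @` T)) _ _ (Kx i)
  (sSup_bounds _ _ cC) _.
- have [|p Tp _] := XT y0 (sbot C c') Xy0 (closedc_sbot _ _); first exact: sbot_le.
  by exists p.
- move=> _ _ [a1 [<- xa1 ao1]] [a2 [<- xa2 ao2]].
  pose a k := sjoin (~~ (b (+) eps k)) (a1 k) (a2 k).
  have le1 : sle_fun b (setc a i (a1 i)) a1.
    by move=> k; rewrite /setc; case: eqP => [->|_]; [exact: sle_refl|exact: sle_meetl].
  have le2 : sle_fun b (setc a i (a2 i)) a2.
    by move=> k; rewrite /setc; case: eqP => [->|_]; [exact: sle_refl|exact: sle_meetr].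
  exists (sjoin c' (a1 i) (a2 i)); split; [|exact: sle_joinl|exact: sle_joinr].
  exists (setc a i (sjoin c' (a1 i) (a2 i))); split; first exact: setcE.
    by move=> k ki; rewrite setcNE// ce_sjoin sle_meet xa1 ?xa2.
  rewrite hj ce_sjoin sjoin_le; apply/andP; split.
    by apply: sle_trans ao1; rewrite ce_sle; exact: h_mono.
  by apply: sle_trans ao2; rewrite ce_sle; exact: h_mono.
- have xc : sle c' (x i) c by have := xu i; rewrite setcE.
  apply: sle_trans xc _; apply: (bounds_le Xc) => y Xy.
  apply: (bounds_le (closedc_bounds c' y)) => y' [Ky' y'y].
  have [p Tp y'p] := XT y y' Xy Ky' y'y.
  by apply: sle_trans y'p _; apply: sle_sSup => //; exists p.
apply: sle_trans ao; apply: ext_closed_le => k.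
by case: (eqVneq k i) => [->|ki] /=; [rewrite ap|exact: xa].
Qed.

(* Smoothness, needed because the extension of g is the sigma extension while *)
(* g preserves meets.                                                         *)
Lemma ext_smooth b i u :
  (forall k, k = i) ->
  (forall a p q, h (setc a i (sjoin (~~ (b (+) eps i)) p q)) =
     sjoin (~~ b) (h (setc a i p)) (h (setc a i q))) ->
  ext b u = ext (~~ b) u.
Proof.
move=> i1 hj; apply: (@sle_anti _ _ b).
  apply: ext_le => x Kx xu; rewrite -sleN; apply: ext_le => y Ky yu.
  rewrite sleN -(extE b Kx) -(extE b Ky); apply: ext_mono => k.
  exact: sle_trans (xu k) ((sle_funN _ _ _).1 yu k).
apply: (bounds_le (closedc_bounds b _)) => z [Kz zu].
pose F a := sle b z (e (h a)).
have appr y : closed_fun (~~ b) y -> sle_fun b u y ->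
    exists2 a, sle_fun b (e \o a) y & F a.
  move=> Ky uy; have [||a ya az] := @ext_closed_approx (~~ b) y z Ky.
  - by rewrite negbK.
  - rewrite sleN; apply: sle_trans zu _; rewrite -sleN; apply: le_ext Ky _.
    exact/sle_funN.
  by exists a; [exact/sle_funN|rewrite /F -sleN].
pose c := b (+) eps i.
(* The closed [x0] lies below [u], since every open tuple above [u] is above some member of [F].
   Preservation of meets closes [F] under meets, so compactness puts [z] below the value at [x0]. *)
pose Y := [set a i | a in F]; pose x0 := sSup (~~ c) (e @` Y).
have x0le a : F a -> sle c x0 (e (a i)).
  by move=> Fa; rewrite -sleN; apply: sle_sSup => //; exists (a i) => //; exists a.
have Kx : closed_fun b (fun=> x0).
  by move=> k; rewrite (i1 k); exact: closedc_sSup.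
have xu : sle_fun b (fun=> x0) u.
  move=> k; rewrite (i1 k) -sleN; apply: (bounds_le (closedc_bounds (~~ c) (u i))).
  move=> y [Ky yu]; rewrite sleN.
  have [||a ay Fa] := appr (fun=> y).
  - by move=> k'; rewrite (i1 k') addNb.
  - by move=> k'; rewrite (i1 k') -sleN.
  exact: sle_trans (x0le a Fa) (ay i).
apply: sle_trans (le_ext Kx xu).
rewrite -sleN; apply: sSup_le => // _ [a xa <-]; rewrite sleN.
have [|||_ [a1 Fa1 <-] aa1] := @ce_directed (~~ c) Y (e (a i)) x0 _ _ (closedc_e _ _)
  (sSup_bounds _ _ cC) _.
- have [||a1 _ Fa1] := appr (fun k => sbot C (~~ (b (+) eps k))).
  + by move=> k; exact: closedc_sbot.
  + by move=> k; exact: sle_sbotN.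
  by exists (a1 i), a1.
- move=> _ _ [a1 Fa1 <-] [a2 Fa2 <-].
  exists (sjoin (~~ c) (a1 i) (a2 i)); split; [|exact: sle_joinl|exact: sle_joinr].
  exists (setc a1 i (sjoin (~~ c) (a1 i) (a2 i))); last exact: setcE.
  rewrite /F /= hj setc_id (_ : setc a1 i (a2 i) = a2); last first.
    by apply/funext => k; rewrite (i1 k) setcE.
  by rewrite ce_sjoin sle_meet; apply/andP.
- by rewrite sleN; exact: xa.
apply: sle_trans Fa1 _; rewrite ce_sle; apply: h_mono => k.
by rewrite (i1 k) -sleN -ce_sle.
Qed.

End Extension.

(** * Meet and join of [C] as extensions of those of [A] *)

Section SignedMeet.
Variables (b : bool) (u : 'I_2 -> C).
Let eps2 : 'I_2 -> bool := fun=> false.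
Let meet2 (a : 'I_2 -> A) : A := sjoin (~~ b) (a ord0) (a ord_max).

Lemma sjoin_mono d0 (T : tbLatticeType d0) c (x y z t : T) : sle c x z -> sle c y t ->
  forall b, sle c (sjoin b x y) (sjoin b z t).
Proof. by case: c => /= xz yt []; [exact: leI2|exact: leU2|exact: leI2|exact: leU2]. Qed.

Lemma ext_closed_meet x : closed_fun eps2 b x ->
  ext_closed eps2 meet2 b x = sjoin (~~ b) (x ord0) (x ord_max).
Proof.
move=> Kx; apply: (@sle_anti _ _ b); last first.
  rewrite -sleN; apply: sSup_le => // _ [a xa <-]; rewrite sleN ce_sjoin.
  by apply: sjoin_mono; [have := xa ord0|have := xa ord_max]; rewrite addbF.
suff le_coord j : sle b (ext_closed eps2 meet2 b x) (x j) by rewrite sle_meet !le_coord.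
have := Kx j; rewrite addbF => /closedcP Kj.
rewrite -sleN; apply: (bounds_le Kj) => _ [p xp <-]; rewrite sleN.
(* Only coordinate [j] is constrained; the other one holds the neutral element of the meet. *)
pose a : 'I_2 -> A := setc (fun=> sbot A (~~ b)) j p.
have xa : sle_fun eps2 b x (e \o a).
  move=> k; rewrite addbF /a /= /setc; case: eqP => [->//|_].
  by rewrite ce_sbot sle_sbotN.
apply: sle_trans (ext_closed_le _ xa) _; rewrite ce_sle.
suff : sle b (meet2 a) (a j) by rewrite /a setcE.
by elim/ord2P: (j); [exact: sle_meetl|exact: sle_meetr].
Qed.

Lemma ext_meet : ext eps2 meet2 b u = sjoin (~~ b) (u ord0) (u ord_max).
Proof.
apply: (@sle_anti _ _ b).
  apply: ext_le => x Kx xu; rewrite ext_closed_meet//.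
  by apply: sjoin_mono; [have := xu ord0|have := xu ord_max]; rewrite addbF.
apply: (bounds_le (closedc_bounds b _)) => z [Kz]; rewrite sle_meet => /andP[z0 z1].
have Kx : closed_fun eps2 b (fun=> z) by move=> i; rewrite addbF.
apply: sle_trans (_ : sle b z (ext_closed eps2 meet2 b (fun=> z))) _.
  by rewrite ext_closed_meet// sle_meet sle_refl.
by apply: le_ext => //; apply: ord2P; rewrite addbF.
Qed.

End SignedMeet.

Lemma meet2_mono b0 b (a a' : 'I_2 -> A) : sle_fun (fun=> false) b a a' ->
  sle b (sjoin b0 (a ord0) (a ord_max)) (sjoin b0 (a' ord0) (a' ord_max)).
Proof.
by move=> aa; apply: sjoin_mono; [have := aa ord0|have := aa ord_max]; rewrite addbF.
Qed.

Lemma sjoin_distr d0 (T : tbDistrLatticeType d0) b (p q a : T) :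
  sjoin (~~ b) (sjoin b p q) a = sjoin b (sjoin (~~ b) p a) (sjoin (~~ b) q a).
Proof. by case: b; [exact: joinIl|exact: meetUl]. Qed.

(** An instance of [ext_preserves]: by [ext_meet] the meet of [C] extends that of [A], and
    distributivity of [A] supplies the hypothesis on pairs. *)
Lemma ce_frame b a (X : set C) c z : X !=set0 -> bounds b X c ->
  (forall y, X y -> sle b (sjoin (~~ b) y a) z) -> sle b (sjoin (~~ b) c a) z.
Proof.
move=> X0 Xc hX; pose u : 'I_2 -> C := fun=> a.
have setE y : sjoin (~~ b) y a = ext (fun=> false)
    (fun a : 'I_2 -> A => sjoin (~~ b) (a ord0) (a ord_max)) b (setc u ord0 y).
  by rewrite ext_meet.
rewrite setE; apply: (bounds_le (@ext_preserves _ (fun=> false) _ _ b ord0 u X c _ X0 _)).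
- by move=> b'; exact: meet2_mono.
- by move=> a' p q; rewrite addbF /setc /= sjoin_distr.
- by rewrite addbF.
- by move=> _ [y Xy <-]; rewrite -setE; exact: hX.
Qed.

End CanonicalExtension.

(** * Canonical extensions of algebras *)

Section Delta.
Context (S : signature) (L : lang) d (A : tbDistrLatticeType d).
Context (O : operations S L A) (alg : is_algebra O).
Context d' (C : tbDistrLatticeType d') (e : A -> C) (ce : canonical_extension e).

Let cC : complete C. Proof. by case: ce. Qed.

Lemma pairs_finite (X : set A) : pairs X -> X !=set0 /\ finite_set X.
Proof.
move=> pX; split; first exact: pairs_inhabited.
case: pX => x [y ->]; rewrite finite_setU; split; exact: finite_set1.
Qed.

Lemma algebra_preserving : node_preserving O (@pairs A).
Proof.
have [opP impP] := alg; apply: node_preservingP => //.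
- exact: pairs_inhabited.
- move=> b a _ c z [p [q ->]] Xc h.
  have -> : c = sjoin b p q.
    apply: (@sle_anti _ _ b).
      by apply: (bounds_le Xc) => w [->|->]; [exact: sle_joinl|exact: sle_joinr].
    by rewrite sjoin_le !(bounds_ub Xc)//; [right|left].
  by rewrite sjoin_distr sjoin_le !h//; [right|left].
- by move=> o u i X x pX; apply: opP; exact: pairs_finite.
Qed.

Lemma algebra_node_mono (nd : node L) b (a a' : 'I_(node_arity S nd) -> A) :
  sle_fun (@node_otype S L nd) b a a' -> sle b (node_eval O a) (node_eval O a').
Proof. by apply: (node_mono (Q := @pairs A)) => //; exact: algebra_preserving. Qed.

Lemma op_sjoin (o : opsym) (a : 'I_(arity S o) -> A) i p q :
  opn O o (finfun (setc a i (sjoin (is_meet_op o (+) otype S o i) p q))) =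
  sjoin (is_meet_op o) (opn O o (finfun (setc a i p))) (opn O o (finfun (setc a i q))).
Proof.
have sk : skeleton (is_meet_op o) (@NOp L o) by case: (o).
have pr := algebra_preserving sk a (X := [set p; q]) _ (bounds_join _ _ _).
apply: (@sle_anti _ _ (is_meet_op o)).
  apply: (bounds_le (pr i _)); first by exists p, q.
  by move=> _ [_ [->|->] <-]; [exact: sle_joinl|exact: sle_joinr].
by rewrite sjoin_le !(bounds_ub (pr i _))//; try (by exists p, q);
  [exists q => //; right|exists p => //; left].
Qed.

Section Epow.
Context (n : nat) (eps : 'I_n -> bool).

Lemma sle_epow d0 (T : porderType d0) b (x y : epow eps T) :
  sle b x y <-> sle_fun eps b x y.
Proof.
rewrite /sle_fun; case: b => /=; split.
- by move=> /forallP h i; have := h i; case: (eps i).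
- by move=> h; apply/forallP => i; have := h i; case: (eps i).
- by move=> /forallP h i; have := h i; case: (eps i).
- by move=> h; apply/forallP => i; have := h i; case: (eps i).
Qed.

Lemma closed_epow b (x : epow eps C) :
  (exists X, bounds (~~ b) (emap e @` X) x) <-> closed_fun e eps b x.
Proof.
split=> [[X Xx] i|Kx].
  exists [set a i | a in X]; apply: boundsI.
    move=> _ [_ [a Xa <-] <-].
    have /sle_epow/(_ i) : sle (~~ b) (emap e a) x by apply: (bounds_ub Xx); exists a.
    by rewrite ffunE addNb.
  move=> y hy.
  have : sle (~~ b) x (upd x i y).
    apply: (bounds_le Xx) => _ [a Xa <-]; apply/sle_epow => k.
    rewrite !ffunE; case: eqP => [->|_].
      by rewrite addNb; apply: hy; exists (a i) => //; exists a.
    have /sle_epow/(_ k) : sle (~~ b) (emap e a) x by apply: (bounds_ub Xx); exists a.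
    by rewrite ffunE.
  by move=> /sle_epow/(_ i); rewrite !ffunE eqxx addNb.
exists [set a | sle b x (emap e a)]; apply: boundsI.
  by move=> _ [a xa <-]; rewrite sleN.
move=> y hy; apply/sle_epow => i; rewrite addNb.
have /closedcP Ki := Kx i; apply: (bounds_le Ki) => _ [p xp <-].
(* The other coordinates hold the largest elements of their signed orders, so that only coordinate
   [i] matters. *)
have : sle (~~ b) (emap e (finfun (setc (fun k => sbot A (~~ (b (+) eps k))) i p) : epow eps A)) y.
  apply: hy; exists (finfun (setc (fun k => sbot A (~~ (b (+) eps k))) i p)) => //=.
  apply/sle_epow => k; rewrite !ffunE /setc; case: eqP => [->//|_].
  by rewrite (ce_sbot ce) sle_sbotN.
by move=> /sle_epow/(_ i); rewrite !ffunE setcE addNb.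
Qed.

Lemma ext_epow b (h : epow eps A -> A) (u : 'I_n -> C) :
  (if b then pi_ext (emap e) e h (finfun u) else sigma_ext (emap e) e h (finfun u)) =
  ext e eps (fun a => h (finfun a)) b u.
Proof.
transitivity (sSup b [set sSup (~~ b) [set e (h a) | a in [set a | sle b x (emap e a)]]
  | x in [set x : epow eps C | (exists X, bounds (~~ b) (emap e @` X) x) /\
           sle b x (finfun u : epow eps C)]]); first by case: b.
congr sSup.
have inE (x : epow eps C) (x' : 'I_n -> C) : x =1 x' ->
    sSup (~~ b) [set e (h a) | a in [set a | sle b x (emap e a)]] =
    ext_closed e eps (fun a => h (finfun a)) b x'.
  move=> xx; congr sSup; apply/seteqP; split=> _ [a xa <-].
    exists a; last by congr (e (h _)); apply/ffunP => i; rewrite ffunE.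
    by move=> i; have /sle_epow/(_ i) := xa; rewrite ffunE xx.
  exists (finfun a) => //; apply/sle_epow => i; rewrite !ffunE xx.
  exact: xa.
apply/seteqP; split=> _ [x [Kx xu] <-].
  exists x; last by rewrite (inE x x).
  split; first exact/closed_epow.
  by move=> i; have /sle_epow/(_ i) := xu; rewrite ffunE.
exists (finfun x); last by apply: inE => i; rewrite ffunE.
split; first by apply/closed_epow => i; rewrite ffunE; exact: Kx.
by apply/sle_epow => i; rewrite !ffunE; exact: xu.
Qed.

End Epow.

Lemma delta_opn (o : opsym) (u : 'I_(arity S o) -> C) :
  opn (delta O e) o (finfun u) =
  ext e (otype S o) (fun a => opn O o (finfun a)) (is_meet_op o) u.
Proof.
have E b := ext_epow (eps := otype S o) b (opn O o) u.
case: o u E => u E; [exact: (E false)| |exact: (E false)|exact: (E true)].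
transitivity (ext e (otype S Og) (fun a => opn O Og (finfun a)) false u).
  exact: (E false).
apply: (@ext_smooth _ _ _ _ _ ce _ _ _ _ _ ord0).
- exact: (@algebra_node_mono (@NOp L Og)).
- by move=> k; exact: (@ord_arity1 1).
- by move=> a p q; exact: (@op_sjoin Og a ord0 p q).
Qed.

Lemma delta_imp (har : is_HAR L) (a b c : C) :
  (Order.meet c a <= b) = (c <= imp (delta O e) har a b).
Proof.
apply/idP/idP => h; first exact: (@sle_sSup _ _ false [set c | Order.meet c a <= b]).
apply: le_trans (leI2 h (lexx a)) _.
apply: (@ce_frame _ _ _ _ _ ce false a [set c | Order.meet c a <= b]) => //.
- by exists \bot; rewrite /= meet0x le0x.
- exact: (sSup_bounds false).
Qed.

Lemma delta_preserving : node_preserving (delta O e) (@inhabited_sets C).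
Proof.
apply: node_preservingP => //.
- by move=> b a X c z X0; exact: (ce_frame ce).
- move=> o u i X x X0 Xx.
  have updE a : upd u i a = finfun (setc u i a).
    by apply/ffunP => k; rewrite !ffunE.
  rewrite updE delta_opn (_ : [set _ | a in X] =
    [set ext e (otype S o) (fun a => opn O o (finfun a)) (is_meet_op o) (setc u i y) | y in X]).
    apply: (ext_preserves ce) => //.
    - exact: (@algebra_node_mono (@NOp L o)).
    - by move=> a p q; exact: (@op_sjoin o a i p q).
    - by rewrite addbC.
  by congr image; apply/funext => a; rewrite updE delta_opn.
- exact: delta_imp.
Qed.

End Delta.

(** * Terms over the canonical extension and their approximation *)

Section DeltaNodes.
Context (S : signature) (L : lang) d (A : tbDistrLatticeType d).
Context (O : operations S L A) (alg : is_algebra O).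
Context d' (C : tbDistrLatticeType d') (e : A -> C) (ce : canonical_extension e).

Let cC : complete C. Proof. by case: ce. Qed.
Local Notation D := (delta O e).

(** The implication of [C] is given by residuation in [C]; identifying it with the pi extension lets
    it be treated like any other node. *)
Lemma ext_imp (har : is_HAR L) (u : 'I_2 -> C) :
  ext e (fun i => i == ord0) (fun a : 'I_2 -> A => imp O har (a ord0) (a ord_max))
    true u = imp D har (u ord0) (u ord_max).
Proof.
have [_ impP] := alg.
move: (imp D har) (delta_imp O ce har) => J resid.
have cl x : closed_fun e (fun i => i == ord0) true x ->
    ext_closed e (fun i => i == ord0)
      (fun a : 'I_2 -> A => imp O har (a ord0) (a ord_max)) true x =
    J (x ord0) (x ord_max).
  move=> Kx; apply: (@sle_anti _ _ false).
    apply: (sSup_le (b := false) cC) => _ [a xa <-] /=; rewrite -resid.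
    have := xa ord0; have := xa ord_max => /= a1 a0.
    apply: le_trans (leI2 (lexx _) a0) _; apply: le_trans a1.
    have [[_ [em _ _ _]] _ _ _] := ce.
    by rewrite -em -[_ <= _]/(sle false _ _) ce_sle /= ?impP.
  apply: (bounds_le (closedc_bounds ce false _)) => k [Kk] /=; rewrite -resid => kx.
  have Kkx : closed_fun e (fun=> false) false (setc (fun=> x ord0) ord0 k : 'I_2 -> C).
    by apply: ord2P; rewrite /setc //=; exact: (Kx ord0).
  (* Compactness enlarges [k] and the closed antecedent to elements of [A] whose meet is still below
     the open consequent. *)
  have := ext_closed_approx ce (@meet2_mono _ A true) Kkx (Kx ord_max).
  rewrite (ext_closed_meet ce Kkx) /= /setc /= => /(_ kx)[a xa ax].
  have /= k0 := xa ord0; have /= x0 := xa ord_max.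
  apply: le_trans k0 _.
  apply: le_trans (_ : e (a ord0) <= e (imp O har (a ord_max) (Order.meet (a ord0) (a ord_max)))) _.
    by rewrite -[_ <= _]/(sle false _ _) ce_sle /= -?impP.
  apply: (@sle_sSup _ _ false) => //.
  exists (setc (fun=> Order.meet (a ord0) (a ord_max)) ord0 (a ord_max)) => //.
  by apply: ord2P; rewrite /setc /=.
apply: (@sle_anti _ _ true).
  apply: ext_le => // x Kx xu; rewrite cl //= -resid.
  have /= u0 := xu ord0; have /= u1 := xu ord_max.
  apply: le_trans (leI2 (lexx _) u0) _; apply: le_trans u1.
  by rewrite resid.
rewrite /= -resid.
apply: (bounds_le (closedc_bounds ce true _)) => y [Ky yu] /=.
rewrite meetC; apply: (ce_frame ce (b := false) _ (closedc_bounds ce false (u ord0))).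
  by exists \bot; split; [exact: (closedc_sbot ce false false)|exact: le0x].
move=> x [Kx xu] /=; rewrite meetC resid.
pose xy : 'I_2 -> C := setc (fun=> y) ord0 x.
have Kxy : closed_fun e (fun i => i == ord0) true xy by apply: ord2P; rewrite /xy /setc.
have xyu : sle_fun (fun i => i == ord0) true xy u by apply: ord2P; rewrite /xy /setc.
by have := le_ext ce (fun a : 'I_2 -> A => imp O har (a ord0) (a ord_max)) Kxy xyu; rewrite cl.
Qed.

Lemma delta_node (nd : node L) : exists b, forall u,
  node_eval D u = ext e (@node_otype S L nd) (node_eval O (nd := nd)) b u.
Proof.
case: nd => [|| | |har|o].
- exists false => u; rewrite (_ : u = e \o (fun=> \bot)); last by apply/funext => -[].
  rewrite (ext_e ce)/=; first by case: ce => -[_ []].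
  by move=> b a a' _; exact: sle_refl.
- exists false => u; rewrite (_ : u = e \o (fun=> \bot)); last by apply/funext => -[].
  rewrite (ext_e ce)/=; first by case: ce => -[_ []].
  by move=> b a a' _; exact: sle_refl.
- by exists false => u; rewrite -[LHS]/(sjoin (~~ false) _ _) -(ext_meet ce).
- by exists true => u; rewrite -[LHS]/(sjoin (~~ true) _ _) -(ext_meet ce).
- by exists true => u; rewrite -[LHS]/(imp D har _ _) -ext_imp.
- by exists (is_meet_op o) => u; exact: delta_opn.
Qed.

Context (N : nat).

Lemma delta_eval (a : 'I_N -> A) (s : term S L N) : eval D (e \o a) s = e (eval O a s).
Proof.
elim: s => [//|nd args IH] /=; have [b0 ->] := delta_node nd.
rewrite -(ext_e ce (@algebra_node_mono _ _ _ _ _ alg nd) b0).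
by congr (ext e _ _ b0); apply/funext => j; exact: IH.
Qed.

Context (eps : 'I_N -> bool).

Lemma delta_eval2 b (a a' : 'I_N -> A) s :
  eval2 eps D b (e \o a) (e \o a') s = e (eval2 eps O b a a' s).
Proof.
elim: s b => [i|nd args IH] b /=; first by case: ifP.
have [b0 ->] := delta_node nd.
rewrite -(ext_e ce (@algebra_node_mono _ _ _ _ _ alg nd) b0).
by congr (ext e _ _ b0); apply/funext => j; exact: IH.
Qed.

Lemma finite_sjoin c (I : finType) (F : I -> A) : exists a,
  (forall i, sle c (F i) a) /\ forall z, (forall i, sle c (e (F i)) z) -> sle c (e a) z.
Proof.
suff [a [ha1 ha2]] : exists a, (forall i, i \in enum I -> sle c (F i) a) /\
    forall z, (forall i, sle c (e (F i)) z) -> sle c (e a) z.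
  by exists a; split=> // i; apply: ha1; rewrite mem_enum.
elim: (enum I) => [|i r [a [ha1 ha2]]].
  by exists (sbot A c); split=> // z _; rewrite (ce_sbot ce) sbot_le.
exists (sjoin c (F i) a); split=> [k|z hz].
  rewrite inE => /predU1P[->|/ha1 h]; first exact: sle_joinl.
  exact: sle_trans h (sle_joinr _ _ _).
by rewrite (ce_sjoin ce) sjoin_le hz ha2.
Qed.

Lemma finite_valuation c (I : finType) (F : I -> 'I_N -> A) : exists a : 'I_N -> A,
  (forall i k, sle (c (+) eps k) (F i k) (a k)) /\
  forall z, (forall i k, sle (c (+) eps k) (e (F i k)) (z k)) ->
    forall k, sle (c (+) eps k) (e (a k)) (z k).
Proof.
have [a ha] := choice (fun k => finite_sjoin (c (+) eps k) (fun i => F i k)).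
exists a; split=> [i k|z hz k]; first by case: (ha k).
by case: (ha k) => _; apply => i; exact: hz.
Qed.

(** In the twisted order critical leaves hold open values and the others closed ones, so a subterm
    signed [b] is open in the order of sign [b]. Compactness at every node then keeps a closed [k]
    below the value at suitable valuations in [A]. *)
Lemma eval2_approx b (s : term S L N) (u v : 'I_N -> C) :
  (forall i, closedc e (~~ eps i) (u i)) -> (forall i, closedc e (eps i) (v i)) ->
  closedc e (~~ b) (eval2 eps D b u v s) /\
  forall k, closedc e b k -> sle b k (eval2 eps D b u v s) -> exists a a',
    [/\ forall i, sle (eps i) (e (a i)) (u i), forall i, sle (eps i) (v i) (e (a' i)) &
        sle b k (e (eval2 eps O b a a' s))].
Proof.
move=> Ku Kv; pose bot i := sbot A (eps i); pose top i := sbot A (~~ eps i).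
have botu i : sle (eps i) (e (bot i)) (u i) by rewrite (ce_sbot ce) sbot_le.
have topv i : sle (eps i) (v i) (e (top i)) by rewrite (ce_sbot ce) sle_sbotN.
elim: s b => [i|nd args IH] b /=.
  rewrite /critical; case: eqP => [->|/eqP ne].
    split=> // k Kk ku; have [a ka au] := ce_interpolate ce Kk (Ku i) ku.
    exists (setc bot i a), top; split=> // [j|]; last by rewrite setcE.
    by rewrite /setc; case: eqP => [->|].
  have bE : b = ~~ eps i by case: b (eps i) ne => -[].
  rewrite bE negbK; split=> // k Kk kv.
  have [|a ka av] := ce_interpolate ce Kk _ kv; first by rewrite negbK.
  exists bot, (setc top i a); split=> // [j|]; last by rewrite setcE.
  by rewrite /setc; case: eqP => [->|//]; rewrite -sleN.
pose y j := eval2 eps D (b (+) node_otype j) u v (args j).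
have Ky : closed_fun e (@node_otype S L nd) (~~ b) y.
  by move=> j; rewrite addNb; case: (IH j (b (+) node_otype j)).
have hm := @algebra_node_mono _ _ _ _ _ alg nd.
have [b0 ->] := delta_node nd; rewrite (extE ce hm _ Ky).
split; first exact: closedc_ext_closed.
move=> k Kk; rewrite -sleN => ky.
(* The arguments are first replaced by a tuple [c] of [A]; each component of [c] is then a closed
   bound for its subterm. *)
have [|c yc ck] := ext_closed_approx ce hm Ky _ ky; first by rewrite negbK.
have appr j : exists aa : ('I_N -> A) * ('I_N -> A),
    [/\ forall i, sle (eps i) (e (aa.1 i)) (u i), forall i, sle (eps i) (v i) (e (aa.2 i)) &
      sle (b (+) node_otype j) (c j) (eval2 eps O (b (+) node_otype j) aa.1 aa.2 (args j))].
  have [_ /(_ (e (c j)) (closedc_e e _ _))] := IH j (b (+) node_otype j).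
  case; first by have := yc j; rewrite addNb sleN.
  by move=> a [a' [h1 h2 h3]]; exists (a, a'); split=> //; rewrite -(ce_sle ce).
have [aa haa] := choice appr.
have [a [a1 a2]] := finite_valuation false (fun j => (aa j).1).
have [a' [a'1 a'2]] := finite_valuation true (fun j => (aa j).2).
exists a, a'; split.
- by move=> i; apply: (a2 u) => j l; case: (haa j) => h1 _ _; exact: h1.
- by move=> i; rewrite -sleN; apply: (a'2 v) => j l; rewrite sleN; case: (haa j) => _ h2 _; exact: h2.
- move: ck; rewrite sleN => /sle_trans; apply; rewrite (ce_sle ce); apply: hm => j.
  have [_ _ cj] := haa j; apply: sle_trans cj _.
  apply: (eval2_mono (Q := @pairs A)) => //; first exact: algebra_preserving.
    by move=> i; exact: a1.
  by move=> i; rewrite -sleN; exact: a'1.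
Qed.

End DeltaNodes.

(** * Canonicity *)

Section Canonicity.
Context (S : signature) (L : lang) (N : nat).
Context (Omega : rel 'I_N) (eps : 'I_N -> bool).
Hypotheses (Oirr : irreflexive Omega) (Otr : transitive Omega).
Context d (A : tbDistrLatticeType d) (O : operations S L A) (alg : is_algebra O).
Context d' (C : tbDistrLatticeType d') (e : A -> C) (ce : canonical_extension e).

Let cC : complete C. Proof. by case: ce. Qed.
Local Notation D := (delta O e).
Let Dpr := delta_preserving alg ce.
Local Notation eval2 := (eval2 eps D).

Section ClopenSolution.
Variables (H : finType) (sg : H -> bool) (al : H -> term S L N) (w : H -> C).
Hypotheses (al_pia : forall h, pia_tree Omega eps (sg h) (al h)).
Hypotheses (w_closed : forall h, closedc e (sg h) (w h)).
Local Notation admissible := (admissible Omega eps D sg al w).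
Local Notation vtop := (vtop eps C).

Let closed_valuation (x : 'I_N -> C) := forall i, closedc e (eps i) (x i).

Lemma closed_below p x : closed_valuation x -> closed_valuation (below Omega eps p x).
Proof.
by move=> Kx i; rewrite /below; case: ifP => // _; exact: closedc_sbot.
Qed.

Lemma constraints_approx u x :
  (forall i, closedc e (~~ eps i) (u i)) -> closed_valuation x ->
  (forall h, sle (sg h) (w h) (eval2 (sg h) u x (al h))) ->
  exists a a', [/\ forall i, sle (eps i) (e (a i)) (u i),
    forall i, sle (eps i) (x i) (e (a' i)) &
    forall h, sle (sg h) (w h) (eval2 (sg h) (e \o a) (e \o a') (al h))].
Proof.
move=> Ku Kx hw.
have appr h : exists aa : ('I_N -> A) * ('I_N -> A),
    [/\ forall i, sle (eps i) (e (aa.1 i)) (u i), forall i, sle (eps i) (x i) (e (aa.2 i)) &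
      sle (sg h) (w h) (eval2 (sg h) (e \o aa.1) (e \o aa.2) (al h))].
  have [_ /(_ _ (w_closed h) (hw h))] := eval2_approx alg ce (sg h) (al h) Ku Kx.
  by move=> [a [a' [h1 h2 h3]]]; exists (a, a'); split=> //; rewrite delta_eval2.
have [aa haa] := choice appr.
have [a [a1 a2]] := finite_valuation ce eps false (fun h => (aa h).1).
have [a' [a'1 a'2]] := finite_valuation ce eps true (fun h => (aa h).2).
exists a, a'; split.
- by move=> i; apply: (a2 u) => h l; case: (haa h) => h1 _ _; exact: h1.
- move=> i; rewrite -sleN; apply: (a'2 x) => h l; rewrite sleN.
  by case: (haa h) => _ h2 _; exact: h2.
- move=> h; have [_ _ wh] := haa h; apply: sle_trans wh _.
  apply: eval2_mono (@pairs_inhabited C) Dpr _ _ => i /=; rewrite (ce_sle ce).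
    exact: a1.
  by rewrite -sleN; exact: a'1.
Qed.

Let emono b u v u' v' (s : term S L N) :
  (forall i, sle (eps i) (u i) (u' i)) -> (forall i, sle (eps i) (v' i) (v i)) ->
  sle b (eval2 b u v s) (eval2 b u' v' s).
Proof. exact: eval2_mono (@pairs_inhabited C) Dpr. Qed.

Lemma admissible_approx p x y : closed_valuation x -> closedc e (~~ eps p) y ->
  admissible p x y -> exists a a', [/\ sle (eps p) (e a) y,
    forall i, sle (eps i) (below Omega eps p x i) (e (a' i)) & admissible p (e \o a') (e a)].
Proof.
move=> Kx Ky adm.
have Ku i : closedc e (~~ eps i) (setc vtop p y i).
  by rewrite /setc; case: eqP => [->//|_]; exact: closedc_sbot.
have [a [a' [h1 h2 h3]]] := constraints_approx Ku (closed_below p Kx) adm.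
exists (a p), a'; split=> //; first by have := h1 p; rewrite setcE.
move=> h; apply: sle_trans (h3 h) _; apply: emono => i.
  exact: (le_vtop_set eps p (e \o a)).
exact: below_le.
Qed.

Let M (p : 'I_N) : set C := range e.
Local Notation mv := (minval Omega eps D sg al w M).

Lemma minval_closed : closed_valuation mv.
Proof.
move=> p; have := minval_bounds eps D cC sg al w Oirr Otr M p.
set X := [set c | _] => Xp; exists [set a | admissible p mv (e a)].
rewrite (_ : e @` _ = X)//; apply/seteqP; split=> [_ [a adm <-]|_ [[a _ <-] adm]].
  by split=> //; exists a.
by exists a.
Qed.

(** In the twisted order [c] is the meet of the open elements above it; below each of these
    compactness finds an admissible element of [A], which is a candidate. *)
Lemma minval_generated p c : admissible p mv c -> sle (eps p) (mv p) c.
Proof.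
move=> adm; rewrite -sleN; apply: (bounds_le (closedc_bounds ce (~~ eps p) c)).
move=> y [Ky]; rewrite !sleN => cy.
have admy : admissible p mv y.
  by apply: (admissible_mono Dpr) adm => // q _; exact: sle_refl.
have [a [a' [ay a'x adma]]] := admissible_approx minval_closed Ky admy.
apply: sle_trans ay; rewrite -sleN.
apply: (bounds_ub (minval_bounds eps D cC sg al w Oirr Otr M p)) => /=; split.
  by exists a.
apply: (admissible_mono Dpr) adma => [q qp|]; last exact: sle_refl.
by have := a'x q; rewrite /below qp.
Qed.

(* The clopen values are chosen for the Omega-maximal variables first: each   *)
(* choice only constrains how close the values of the smaller variables must  *)
(* be to their minimal values.                                                *)
Lemma clopen_solution v : solution D sg al w v ->
  exists a : 'I_N -> A, solution D sg al w (e \o a).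
Proof.
move=> sol.
have solm : solution D sg al w mv.
  exact: (minval_solution cC Dpr al_pia Oirr Otr minval_generated sol).
have mtop := solution_vtop Dpr (fun i => sle_refl (eps i) (mv i)) solm.
(* After [m] rounds admissibility holds at all variables of rank at least [N - m]; the next round
   changes values only at ranks below [N - m - 1]. *)
suff step m : exists a : 'I_N -> A,
    [/\ forall i, sle (eps i) (mv i) (e (a i)),
        forall h, sle (sg h) (w h) (eval2 (sg h) vtop (e \o a) (al h)) &
        forall p, (N <= rank Omega p + m)%N -> admissible p (e \o a) (e (a p))].
  have [a [ma wa adm]] := step N; exists a.
  apply: (@admissible_solution _ _ _ _ _ _ _ _ Dpr _ _ _ _ al_pia _ (fun p => [set e (a p)])) => //.
    by move=> p; exact: bounds1.
  by move=> p _ ->; apply: adm; rewrite leq_addl.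
elim: m => [|m [a [ma wa adm]]].
  have [|a0 [a' [_ ma' wa']]] := constraints_approx _ minval_closed mtop.
    by move=> i; exact: closedc_sbot.
  exists a'; split=> //.
    move=> h; apply: sle_trans (wa' h) _; apply: emono => i; last exact: sle_refl.
    exact: sle_sbotN.
  by move=> p; rewrite addn0 leqNgt (rank_lt_size Oirr).
have appr p : exists a' : 'I_N -> A,
    (forall i, sle (eps i) (mv i) (e (a' i))) /\ admissible p (e \o a') (e (a p)).
  have admp : admissible p mv (e (a p)).
    have admv : admissible p mv (mv p) by exact: solution_admissible.
    by apply: (admissible_mono Dpr) admv => // q _; exact: sle_refl.
  have [c [a' [cap xa' adma]]] := admissible_approx minval_closed (closedc_e _ _ _) admp.
  exists (fun q => if Omega q p then a' q else sbot A (~~ eps q)); split.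
    move=> i; case: ifP => ip; last by rewrite (ce_sbot ce) sle_sbotN.
    by have := xa' i; rewrite /below ip.
  apply: (admissible_mono Dpr) adma => // q qp /=.
  by rewrite qp sle_refl.
have [b hb] := choice appr.
have [a' [a'1 a'2]] := finite_valuation ce eps true b.
pose r q := if (rank Omega q + m.+1 < N)%N then sjoin (~~ eps q) (a q) (a' q) else a q.
have ra i : sle (eps i) (e (r i)) (e (a i)).
  by rewrite (ce_sle ce) /r; case: ifP => _; [exact: sle_meetl|exact: sle_refl].
exists r; split.
- move=> i; rewrite /r; case: ifP => // _; rewrite (ce_sjoin ce) sle_meet ma /=.
  by rewrite -sleN; apply: (a'2 mv) => p k; rewrite sleN; case: (hb p).
- by move=> h; apply: sle_trans (wa h) _; apply: emono => // i; exact: sle_refl.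
- move=> p pm.
  have rp : r p = a p by rewrite /r ltnNge pm.
  have [Nm|mN] := leqP N (rank Omega p + m); rewrite rp.
    apply: (admissible_mono Dpr) (adm _ Nm) => [q _|]; first exact: ra.
    exact: sle_refl.
  have [_] := hb p.
  apply: (admissible_mono Dpr) => [q qp /=|]; last exact: sle_refl.
  rewrite (ce_sle ce); have qm : (rank Omega q + m.+1 < N)%N.
    by apply: leq_trans mN; rewrite ltnS addnS ltn_add2r rank_lt.
  rewrite /r qm; apply: sle_trans (sle_meetr _ _ _) _.
  by rewrite -sleN; exact: a'1.
Qed.

End ClopenSolution.

Lemma canonical (s t : term S L N) :
  inductive_tree Omega eps false s -> inductive_tree Omega eps true t ->
  valid O s t -> valid D s t.
Proof.
move=> si ti val.
apply/(valid_holes s t Dpr (G := closedc e)) => [b a|w Kw [v sol]].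
  exists [set y | closedc e b y /\ sle b y a]; last exact: closedc_bounds.
  split; last by move=> y [].
  by exists (sbot C b); split; [exact: closedc_sbot|exact: sbot_le].
have pia h := @ineq_hole_pia _ _ _ s t Omega eps h si ti.
have [a sola] := clopen_solution pia Kw sol.
apply: (hole_solution_le Dpr sola); rewrite !(delta_eval alg ce).
by rewrite -[_ <= _]/(sle false _ _) (ce_sle ce) /=.

Qed.

End Canonicity.

Theorem theorem7p13 (S : signature) (L : lang) (N : nat) (s t : term S L N)
    (ind : inductive_ineq s t) :
  (exists chi : sentence S,
     forall (d : Order.disp_t) (A : tbDistrLatticeType d) (O : operations S L A),
       is_perfect O -> (valid O s t <-> models (dual_frame O) chi)) /\
  (forall (d : Order.disp_t) (A : tbDistrLatticeType d) (O : operations S L A),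
     is_algebra O ->
     forall (d' : Order.disp_t) (C : tbDistrLatticeType d') (e : A -> C),
       canonical_extension e ->
       valid O s t -> valid (delta O e) s t).
Proof.
have [Omega [eps [Oirr Otr si ti]]] := ind; split.
  exact: elementary Oirr Otr si ti.
by move=> d A O alg d' C e ce; exact: (canonical Oirr Otr alg ce si ti).
Qed.
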